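(* Let $K$ be a (large enough) number field with ring of integers $R$. Consider the semidirect product $G:=N\rtimes Q$ of two finite groups $N$ and $Q$, with $N$ abelian. Let $L$ and $P$ be abelian subgroups of $N$ and $Q$, respectively. Set $M=LP$. Let $\tau\in Q$. Suppose that $N,Q,L,P$ and $\tau$ satisfy the following conditions: (i) $L$ and $P$ are isomorphic and commute with one another. (ii) $Q$ acts on $N$ faithfully. (iii) $N=L\oplus(\tau\cdot L)$, where $N$ is written additively. (iv) $N^{\tau}\neq\{1\}$. (v) $\widehat{N}^{\sigma\tau}=\big(\widehat{N}^{\tau}\big)\cap\big(\widehat{N}^{\sigma\tau\sigma^{-1}}\big)=\{\varepsilon\}$ for every $\sigma\in P$ with $\sigma\neq1$. Let $J$ be the twist in $KM\otimes KM$ arising from an isomorphism $f:P\to\widehat{L}$. Then $(KG)_J$ admits a unique Hopf order over $R$. This Hopf order is generated, as an $R$-subalgebra, by the primitive idempotents of $KN$ and the elements of $Q$.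
   Context: Hopf orders. Let $H$ be a finite-dimensional Hopf algebra over a field $K$ and $R$ a subring of $K$. A Hopf order of $H$ over $R$ is a finitely generated projective $R$-submodule $X$ of $H$ such that the natural map $X\otimes_R K\to H$ is an isomorphism and $1_H\in X$, $XX\subseteq X$, $\Delta(X)\subseteq X\otimes_R X$ (viewed inside $H\otimes_K H$), $\varepsilon(X)\subseteq R$, $S(X)\subseteq X$, where $\Delta,\varepsilon,S$ are the coproduct, counit and antipode of $H$. ''Large enough'' means that $KN$ splits as an algebra, i.e. is a product of copies of $K$ (then $KM$ splits as well). Notation. For a finite abelian group $A$ with $KA$ split, $\widehat{A}$ is the group of characters $A\to K^\times$, $\varepsilon$ is the trivial character, and for $\phi\in\widehat{A}$ the primitive idempotent is $e_\phi=\frac{1}{|A|}\sum_{a\in A}\phi(a^{-1})a\in KA$. The group $Q$ acts on $N$ via the semidirect product, $q\cdot n=qnq^{-1}$, and on $\widehat{N}$ by $(q\triangleright\nu)(n)=\nu(q^{-1}\cdot n)$. $N^q$ and $\widehat{N}^q$ denote the subgroups of elements fixed by $q\in Q$. $N=L\oplus(\tau\cdot L)$ means that $N$ is the internal direct sum of its subgroups $L$ and $\tau\cdot L=\{\tau\cdot l:l\in L\}$. The twist arising from $f$. $M=LP$ is an abelian subgroup of $G$, the internal direct product of $L$ and $P$. Given an isomorphism $f:P\to\widehat{L}$, the twist arising from $f$ is $$J=\sum_{\lambda\in\widehat{L}}\sum_{\rho\in\widehat{P}}\rho(f^{-1}(\lambda))\,e_\lambda\otimes e_\rho,\qquad e_\lambda\in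 KL,\ e_\rho\in KP.$$ (It is the twist $\sum_{\phi,\psi\in\widehat M}\omega(\phi,\psi)e_\phi\otimes e_\psi$ for the $2$-cocycle $\omega(\rho_1\lambda_1,\rho_2\lambda_2)=\rho_2(f^{-1}(\lambda_1))$ on $\widehat{M}=\widehat{P}\widehat{L}$.) The Hopf algebra $(KG)_J$ equals $KG$ as an algebra, has the same counit, coproduct $\Delta_J(h)=J\Delta(h)J^{-1}$ and antipode $S_J(h)=U_JS(h)U_J^{-1}$, where $U_J=\sum J^{(1)}S(J^{(2)})$ for $J=\sum J^{(1)}\otimes J^{(2)}$, and $\Delta,S$ are those of the group algebra $KG$. *)

(* Defs.v *)
From HB Require Import structures.
From mathcomp Require Import all_boot all_order all_fingroup all_algebra all_field.
From mathcomp Require Import boolp classical_sets functions fsbigop.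

Set Implicit Arguments.
Unset Strict Implicit.
Unset Printing Implicit Defensive.

Import GRing.Theory.

Local Open Scope classical_set_scope.
Local Open Scope ring_scope.

Section RingOfIntegers.
Variable K : fieldExtType rat.

Definition algebraic_integer : {pred K} :=
  [pred x : K | `[< integralOver (intr : int -> K) x >]].

Lemma algebraic_integerP (x : K) :
  reflect (integralOver (intr : int -> K) x) (x \in algebraic_integer).
Proof. exact: asboolP. Qed.

Fact algebraic_integer_subring : subring_closed algebraic_integer.
Proof.
pose int_K : {rmorphism int -> K} := intr.
split=> [|x y /algebraic_integerP xP /algebraic_integerP yP
         |x y /algebraic_integerP xP /algebraic_integerP yP];
  apply/algebraic_integerP.
- exact: (integral1 int_K).
- exact: (@integral_sub _ _ int_K).
- exact: (@integral_mul _ _ int_K).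
Qed.

HB.instance Definition _ :=
  GRing.isSubringClosed.Build K algebraic_integer algebraic_integer_subring.

Record ring_of_integers := RingOfIntegers {
  int_val : K; _ : int_val \in algebraic_integer }.

HB.instance Definition _ := [isSub for int_val].
HB.instance Definition _ := [Choice of ring_of_integers by <:].
HB.instance Definition _ :=
  [SubChoice_isSubComNzRing of ring_of_integers by <:].

End RingOfIntegers.

(* In the next section, [iota : R -> K] is a ring morphism and [K]-modules are
   seen as [R]-modules by restriction of scalars along [iota].  A map out of an
   [R]-submodule [X] of [U] is represented by a function on [U], of which only
   the restriction to [X] matters. *)

Section Modules.
Variables (R K : comNzRingType) (iota : {rmorphism R -> K}).

Definition is_submodule (U : lmodType K) (X : set U) :=
  X 0 /\ forall (r : R) x y, X x -> X y -> X (iota r *: x + y).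

Definition linear_on (U : lmodType K) (X : set U) (V : lmodType R)
    (p : U -> V) :=
  forall (r : R) x y, X x -> X y -> p (iota r *: x + y) = r *: p x + p y.

Definition finitely_generated (U : lmodType K) (X : set U) :=
  exists n (x : 'I_n -> U), (forall i, X (x i)) /\
    forall y, X y -> exists r : 'I_n -> R, y = \sum_i iota (r i) *: x i.

Definition projective (U : lmodType K) (X : set U) :=
  forall (V W : lmodType R) (g : {linear V -> W}) (p : U -> W),
    (forall w, exists v, g v = w) -> linear_on X p ->
  exists q : U -> V, linear_on X q /\ forall x, X x -> g (q x) = p x.

(* [t : X x Y -> T] makes [T] the tensor product of the [R]-modules [X] and
   [Y]: it is the universal [R]-bilinear map. *)
Definition is_tensor_product (U W T : lmodType K) (X : set U) (Y : set W)
    (t : U -> W -> T) :=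
  [/\ forall (r : R) x x' y, X x -> X x' -> Y y ->
        t (iota r *: x + x') y = iota r *: t x y + t x' y,
      forall (r : R) x y y', X x -> Y y -> Y y' ->
        t x (iota r *: y + y') = iota r *: t x y + t x y'
    & forall (V : lmodType R) (b : U -> W -> V),
        (forall y, Y y -> linear_on X (b^~ y)) ->
        (forall x, X x -> linear_on Y (b x)) ->
      exists! h : T -> V,
        linear_on setT h /\ forall x y, X x -> Y y -> h (t x y) = b x y].

Definition is_subalgebra (A : lalgType K) (X : set A) :=
  [/\ is_submodule X, X 1 & forall x y, X x -> X y -> X (x * y)].

Definition subalgebra_generated (A : lalgType K) (S : set A) : set A :=
  smallest (@is_subalgebra A) S.

End Modules.

(* The structure maps of a finite-dimensional Hopf algebra, with a chosen model
   of its tensor square.  The compatibility axioms between these maps are not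
   recorded, since the definition of a Hopf order does not refer to them. *)
Record hopf_structure (K : fieldType) := HopfStructure {
  hopf_alg :> falgType K;
  hopf_sq : lmodType K;
  hopf_tens : hopf_alg -> hopf_alg -> hopf_sq;
  hopf_tensP :
    is_tensor_product (idfun : {rmorphism K -> K}) setT setT hopf_tens;
  hopf_comul : hopf_alg -> hopf_sq;
  hopf_counit : hopf_alg -> K;
  hopf_antipode : hopf_alg -> hopf_alg }.

Section HopfOrder.
Variables (K : fieldType) (S : {pred K}) (R : subComNzRingType S).
Variable H : hopf_structure K.

Local Notation iota := (val : {rmorphism R -> K}).

(* The image of [X] tensor [X] (over [R]) in [H] tensor [H]. *)
Definition tensor_image (X : set H) : set (hopf_sq H) :=
  [set z | exists n (a b : 'I_n -> H),
    [/\ forall i, X (a i), forall i, X (b i)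
      & z = \sum_i hopf_tens (a i) (b i)]].

(* The natural map from [X] tensor [K] to [H] is an isomorphism iff
   [(x, k) |-> k *: x] is a universal [R]-bilinear map on [X x K]. *)
Record is_hopf_order (X : set H) : Prop := IsHopfOrder {
  hopf_order_submodule : is_submodule iota X;
  hopf_order_fg : finitely_generated iota X;
  hopf_order_projective : projective iota X;
  hopf_order_span :
    is_tensor_product iota X setT (fun (x : H) (k : K^o) => k *: x);
  hopf_order1 : X 1;
  hopf_orderM : forall x y, X x -> X y -> X (x * y);
  hopf_order_comul : forall x, X x -> tensor_image X (hopf_comul x);
  hopf_order_counit : forall x, X x -> exists r : R, iota r = hopf_counit x;
  hopf_order_antipode : forall x, X x -> X (hopf_antipode x) }.

End HopfOrder.

(* The group algebra is the space of functions on the group, with convolution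
   as product. *)
Definition galg (K : fieldType) (gT : finGroupType) := {ffun gT -> K^o}.

Section GroupAlgebra.
Variables (K : fieldType) (gT : finGroupType).

HB.instance Definition _ := Vector.copy (galg K gT) {ffun gT -> K^o}.

Implicit Types u v w : galg K gT.

Definition gbase (g : gT) : galg K gT := [ffun x => (x == g)%:R].

Definition gmul u v : galg K gT :=
  [ffun x => \sum_y u y * v (y^-1 * x)%g].

Fact gmulA : associative gmul.
Proof.
move=> u v w; apply/ffunP=> x; rewrite !ffunE.
under eq_bigr do rewrite ffunE mulr_sumr.
under [RHS]eq_bigr do rewrite ffunE mulr_suml.
rewrite [RHS]exchange_big /=; apply: eq_bigr => y _.
rewrite [RHS](reindex_inj (mulgI y)) /=; apply: eq_bigr => z _.
by rewrite mulKg invMg mulrA mulgA.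
Qed.

Fact gmul1l : left_id (gbase 1) gmul.
Proof.
move=> u; apply/ffunP=> x; rewrite !ffunE (bigD1 1%g) //= big1 => [|y y1].
  by rewrite ffunE eqxx mul1r invg1 mul1g addr0.
by rewrite ffunE (negPf y1) mul0r.
Qed.

Fact gmul1r : right_id (gbase 1) gmul.
Proof.
move=> u; apply/ffunP=> x; rewrite !ffunE (bigD1 x) //= big1 => [|y yx].
  by rewrite ffunE mulVg eqxx mulr1 addr0.
by rewrite ffunE -eq_mulVg1 (negPf yx) mulr0.
Qed.

Fact gmulDl : left_distributive gmul +%R.
Proof.
move=> u v w; apply/ffunP=> x; rewrite !ffunE -big_split.
by apply: eq_bigr => y _; rewrite ffunE mulrDl.
Qed.

Fact gmulDr : right_distributive gmul +%R.
Proof.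
move=> u v w; apply/ffunP=> x; rewrite !ffunE -big_split.
by apply: eq_bigr => y _; rewrite ffunE mulrDr.
Qed.

Fact gbase1_neq0 : gbase 1 != 0.
Proof. by apply/eqP=> /ffunP/(_ 1%g)/eqP; rewrite !ffunE eqxx oner_eq0. Qed.

HB.instance Definition _ := GRing.Zmodule_isNzRing.Build (galg K gT)
  gmulA gmul1l gmul1r gmulDl gmulDr gbase1_neq0.

Fact gscaleAl (k : K) u v : k *: (u * v) = (k *: u) * v.
Proof.
apply/ffunP=> x; rewrite !ffunE scaler_sumr.
by apply: eq_bigr => y _; rewrite ffunE -scalerAl.
Qed.

HB.instance Definition _ :=
  GRing.Lmodule_isLalgebra.Build K (galg K gT) gscaleAl.

Fact gscaleAr (k : K) u v : k *: (u * v) = u * (k *: v).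
Proof.
apply/ffunP=> x; rewrite !ffunE scaler_sumr.
by apply: eq_bigr => y _; rewrite ffunE -scalerAr.
Qed.

HB.instance Definition _ :=
  GRing.Lalgebra_isAlgebra.Build K (galg K gT) gscaleAr.

HB.instance Definition _ := Algebra_isFalgebra.Build K (galg K gT).

Lemma gbaseM g h : gbase g * gbase h = gbase (g * h)%g.
Proof.
apply/ffunP=> x; rewrite !ffunE (bigD1 g) //= big1 => [|y yg].
  by rewrite !ffunE eqxx mul1r addr0 -(inj_eq (mulgI g)) mulKVg.
by rewrite ffunE (negPf yg) mul0r.
Qed.

Lemma galg_sum u : u = \sum_g (u g : K) *: gbase g.
Proof.
apply/ffunP=> x; rewrite sum_ffunE (bigD1 x) //= big1 => [|y yx].
  by rewrite !ffunE eqxx addr0 /GRing.scale /= mulr1.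
by rewrite !ffunE eq_sym (negPf yx) scaler0.
Qed.

Definition gcounit u : K := \sum_g u g.

Definition gantipode u : galg K gT := \sum_g (u g : K) *: gbase g^-1.

End GroupAlgebra.

Definition splits_as_algebra (K : fieldType) (A : algType K) :=
  exists n (phi : A -> {ffun 'I_n -> K^o}),
    [/\ linear phi, monoid_morphism phi & bijective phi].

(* The tensor square of [galg K gT] is modelled by [galg K (gT * gT)], as
   justified by [gtensP]. *)

Section TensorSquare.
Variables (K : fieldType) (gT : finGroupType).
Local Notation KG := (galg K gT).
Local Notation KG2 := (galg K (gT * gT)%type).
Implicit Types u v : KG.

Definition gtens u v : KG2 := [ffun p => u p.1 * v p.2].

Lemma gtens_base g h : gtens (gbase K g) (gbase K h) = gbase K (g, h).
Proof. by apply/ffunP=> -[x y]; rewrite !ffunE xpair_eqE -natrM mulnb. Qed.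

Lemma gtensP :
  is_tensor_product (idfun : {rmorphism K -> K}) setT setT gtens.
Proof.
split=> [r x x' y _ _ _|r x y y' _ _ _|V b bl br].
- by apply/ffunP=> p; rewrite !ffunE mulrDl -scalerAl.
- by apply/ffunP=> p; rewrite !ffunE mulrDr -scalerAr.
have lin_sum (U : lmodType K) (h : U -> V) (J : finType) (c : J -> K) F :
    linear_on (idfun : {rmorphism K -> K}) setT h ->
  h (\sum_(i : J) c i *: F i) = \sum_i c i *: h (F i).
  move=> hl; have h0 : h 0 = 0.
    by have := hl (- 1) 0 0 I I; rewrite /= scaler0 addr0 scaleN1r addNr.
  elim/big_rec2: _ => [|i s t _ <-]; first exact: h0.
  by rewrite (hl (c i)).
exists (fun w : KG2 =>
  \sum_p (w p : K) *: b (gbase K p.1) (gbase K p.2)).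
split; [split=> [r x y _ _|u v _ _]|move=> h [hl hb]].
- rewrite scaler_sumr -big_split; apply: eq_bigr => p _.
  by rewrite !ffunE scalerDl scalerA.
- rewrite [u in RHS]galg_sum (lin_sum _ (b^~ v)); last exact: bl.
  under [RHS]eq_bigr => g _.
    rewrite [v in X in _ *: X]galg_sum (lin_sum _ (b _)); last exact: br.
    rewrite scaler_sumr; over.
  rewrite pair_big /=; apply: eq_bigr => -[g h] _.
  by rewrite ffunE scalerA.
- apply/funext=> w; rewrite [w in RHS]galg_sum lin_sum //.
  by apply: eq_bigr => -[g h'] _; rewrite -gtens_base hb.
Qed.

Definition gcomul u : KG2 := \sum_g (u g : K) *: gbase K (g, g).

(* The linear map [a (x) b |-> a * S b]. *)
Definition gmul_antipode (w : KG2) : KG :=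
  \sum_p (w p : K) *: (gbase K p.1 * gantipode (gbase K p.2)).

(* The Hopf algebra (KG)_J: [^-1] is the inverse in the algebras [KG] and
   [KG2], meaningful when [J] is a twist. *)
Definition twisted_galg (J : KG2) : hopf_structure K :=
  let U := gmul_antipode J in
  HopfStructure gtensP (fun u => J * gcomul u * J^-1)
    (@gcounit K gT) (fun u => U * gantipode u * U^-1).

End TensorSquare.

Section Characters.
Variables (K : fieldType) (gT : finGroupType).
Implicit Types (A : {group gT}) (chi nu : {ffun gT -> K}).

(* A character [A -> K^x] is extended by [0] outside [A], so that equality of
   characters is equality of functions. *)
Definition dual A : set {ffun gT -> K} :=
  [set chi : {ffun gT -> K} | [/\ {in A &, {morph chi : x y / (x * y)%g >-> x * y}},
                 forall x, x \in A -> chi x != 0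
               & forall x, x \notin A -> chi x = 0]].

Definition trivial_char A : {ffun gT -> K} := [ffun x => (x \in A)%:R].

Definition char_idem A chi : galg K gT :=
  #|A|%:R^-1 *: \sum_(a in A) chi a^-1%g *: gbase K a.

(* The action of [q] on [chi]: here [x ^ q] is [q^-1 * x * q]. *)
Definition char_act (q : gT) chi : {ffun gT -> K} :=
  [ffun x => chi (x ^ q)%g].

Definition dual_fix A (q : gT) : set {ffun gT -> K} :=
  [set chi : {ffun gT -> K} | dual A chi /\ char_act q chi = chi].

Definition dual_iso (P L : {group gT}) (f : gT -> {ffun gT -> K}) :=
  {in P &, forall x y a, f (x * y)%g a = f x a * f y a} /\
  set_bij [set` P] (dual L) f.

Definition dual_iso_inv (P : {group gT}) (f : gT -> {ffun gT -> K}) chi : gT :=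
  odflt 1%g [pick x in P | f x == chi].

(* The sums are finite: a finite group has finitely many characters. *)
Definition twist (L P : {group gT}) (f : gT -> {ffun gT -> K}) :
    galg K (gT * gT)%type :=
  \sum_(lam \in dual L) \sum_(rho \in dual P)
    rho (dual_iso_inv P f lam) *: gtens (char_idem L lam) (char_idem P rho).

End Characters.

(* Main.v *)
Require Import Defs.
From HB Require Import structures.
From mathcomp Require Import all_boot all_order all_fingroup all_algebra all_field.
From mathcomp Require Import boolp classical_sets functions fsbigop.
From mathcomp Require Import ring.

Set Implicit Arguments.
Unset Strict Implicit.
Unset Printing Implicit Defensive.

Import GRing.Theory Num.Theory.

Local Open Scope classical_set_scope.
Local Open Scope ring_scope.

(* The primitive idempotents of KN and Q span a free lattice Y containing
   the twist J = sum_(x in P) e_(f x) (x) x, so Y is a Hopf order for both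
   the twisted and the untwisted coproduct.

   Let Z be any Hopf order and Z* its dual. An element h is in Z as soon as
   phi(h) is integral for all phi in Z*, and traces of representations of Z
   and of Z* are integral; hence the characters of G are in Z*, and the
   characters of comodules, e.g. the elements of P, are in Z. The coalgebra
   K[M tau M] is a matrix coalgebra, whose character is c = sum_(a,b in P) a
   e_eps tau b in Z, with e_eps in KN because N = L (+) tau L. Let chi be
   the character of K[G/Q], so that chi(e_nu q) = 1 if q fixes nu, and 0
   otherwise. By (v), (chi (x) id) Delta_J(c) - c is the sum of the a e_nu
   tau a^-1 for a in P and nu <> eps a tau-fixed character of N, and its
   power of exponent #[tau] is the sum of the e_lambda over the restrictions
   lambda <> eps to L of these nu, of which there is at least one by (iv).
   Boolean combinations of translates of this element yield all the e_lambda
   with lambda a character of L. So J is in Z (x) Z, Z is an order for the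
   untwisted coproduct, and all group elements are in Z, being group-like.
   It follows that Z contains Y.

   Conversely, for each character nu of N the function s_nu(n q) = nu(n) [q
   fixes nu] is in Z*, since it gives an eigenvalue of e_nu z. The dual
   order Z* is closed under pointwise products, and Q acts faithfully, so
   the product of all the s_nu s_(nu^-1), the indicator function of N, is in
   Z*. Hence all coordinates on Y of elements of Z are integral. *)

(** * Integrality of eigenvalues and traces *)

Section Integrality.
Variable K : fieldExtType rat.
Local Notation O := (@algebraic_integer K).

(** A number field is countable, being finite-dimensional over the rationals, and a countable field
    has an explicit algebraic closure. *)
Lemma number_field_closure :
  {L : closedFieldType & {rmorphism K -> L}}.
Proof.
pose cK : isCountable K := CanIsCountable (@VectorInternalTheory.v2rK rat K).
pose F : countFieldType := HB.pack (K : Type) (GRing.Field.class K) cK.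
have [L [h _]] := countable_algebraic_closure F.
by exists L; exact: h.
Qed.

Lemma fmorph_map_poly_int (L : fieldType) (h : {rmorphism K -> L})
  (p : {poly int}) :
  map_poly (intr : int -> L) p = map_poly h (map_poly (intr : int -> K) p).
Proof. by apply/polyP=> j; rewrite !coef_map /= rmorph_int. Qed.

(** The characteristic polynomial is monic with algebraic integers as coefficients, and integrality
    is transitive. The root is taken in an extension [L] because eigenvalues need not lie in [K]. *)
Lemma root_char_poly_integral (L : fieldType) (h : {rmorphism K -> L}) n
    (r : 'M[K]_n) (t : L) :
  (forall i j, r i j \in O) -> root (char_poly (map_mx h r)) t ->
  integralOver (intr : int -> L) t.
Proof.
move=> rO rt; pose s : 'M[ring_of_integers K]_n :=
  \matrix_(i, j) RingOfIntegers (rO i j).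
have rE : r = map_mx val s by apply/matrixP=> i j; rewrite !mxE.
rewrite {}rE -map_mx_comp -map_char_poly in rt.
apply: (integral_root_monic _ rt) => [|c].
  by apply: monic_map; exact: char_poly_monic.
move=> /(nthP 0)[i]; rewrite size_map_poly_id0 => [|]; last first.
  by rewrite (monicP (char_poly_monic _)) rmorph1 oner_eq0.
move=> ilt <-; rewrite coef_map /=.
case: (_`_i) => x /= /algebraic_integerP[p mp px].
exists p => //; move: px; rewrite /root.
by rewrite (fmorph_map_poly_int h) horner_map fmorph_eq0.
Qed.

Lemma fmorph_integral (L : fieldType) (h : {rmorphism K -> L}) (x : K) :
  integralOver (intr : int -> L) (h x) -> x \in O.
Proof.
move=> [p mp px]; apply/algebraic_integerP; exists p => //; move: px.
by rewrite (fmorph_map_poly_int h) /root horner_map fmorph_eq0.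
Qed.

Lemma eigenvalue_integral n (r : 'M[K]_n) (t : K) :
  (forall i j, r i j \in O) -> eigenvalue r t -> t \in O.
Proof.
move=> rO; rewrite eigenvalue_root_char => rt.
apply: (@fmorph_integral _ idfun);
  apply: (root_char_poly_integral (h := idfun) rO).
by rewrite map_mx_id.
Qed.

(* The span of the matrices [B j] contains the identity and is stable under
   [M]; an eigenvector of [M] yields an eigenvector of [r]. *)
Lemma mxtrace_integral n m (M : 'M[K]_n) (r : 'M[K]_m) (B : 'I_m -> 'M[K]_n)
    (s : 'I_m -> K) :
  (forall i j, r i j \in O) ->
  (forall j, M *m B j = \sum_i r i j *: B i) ->
  1%:M = \sum_j s j *: B j -> \tr M \in O.
Proof.
move=> rO MB sB; case: n => [|n] in M B MB sB *.
  by rewrite /mxtrace big_ord0 rpred0.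
have [L h] := number_field_closure; apply: (fmorph_integral (h := h)).
have [z Dz] := closed_field_poly_normal (char_poly (map_mx h M)).
rewrite (monicP (char_poly_monic _)) scale1r in Dz.
have sz : size z = n.+1.
  by apply: succn_inj; rewrite -(size_prod_XsubC z id) -Dz size_char_poly.
(* The trace is the sum of the roots of the characteristic polynomial in [L], so it suffices that
   each root is integral. *)
rewrite -trace_map_mx -[\tr _]opprK -char_poly_trace // Dz -sz.
rewrite coefPn_prod_XsubC ?sz // opprK big_seq.
elim/big_ind: _ => [|x y|x xz]; first exact: integral0;
  first exact: integral_add.
have : root (char_poly (map_mx h M)) x by rewrite Dz root_prod_XsubC.
rewrite -eigenvalue_root_char => /eigenvalueP[v vM v0].
(* Otherwise [v] kills every [B j], hence also the identity, which is a combination of them. *)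
have [j [k vBjk]] : exists j k, (v *m map_mx h (B j)) 0 k != 0.
  apply: contraPP (v0) => /forallNP vB; apply/negP; rewrite negbK.
  rewrite -[v]mulmx1 -(map_mx1 h) sB raddf_sum mulmx_sumr big1 // => i _.
  rewrite [X in v *m X]map_mxZ -scalemxAr; apply/eqP; rewrite scaler_eq0 orbC.
  apply/orP; left; apply/eqP/rowP => k; rewrite [RHS]mxE.
  by apply/eqP/negPn/negP=> vBk; apply: (vB i); exists k.
apply: (root_char_poly_integral rO); rewrite -eigenvalue_root_char.
(* The [k]-th entries of the vectors [v B i] form the eigenvector of [r]; its [j]-th entry is
   nonzero. *)
apply/eigenvalueP; exists (\row_i (v *m map_mx h (B i)) 0 k).
  apply/rowP=> i; rewrite [RHS]mxE [X in x * X]mxE.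
  have -> : x * (v *m map_mx h (B i)) 0 k = (v *m map_mx h (M *m B i)) 0 k.
    by rewrite map_mxM mulmxA vM -scalemxAl [RHS]mxE.
  rewrite MB raddf_sum mulmx_sumr summxE [LHS]mxE.
  by apply: eq_bigr => l _; rewrite [X in v *m X]map_mxZ -scalemxAr !mxE mulrC.
by apply/eqP=> /rowP/(_ j)/eqP;
  rewrite [X in X == _]mxE [X in _ == X]mxE (negPf vBjk).
Qed.

Lemma trace_integral (I : finType) (A : {set I}) (M : I -> I -> K) m
    (r : 'I_m -> 'I_m -> K) (B : 'I_m -> I -> I -> K) (s : 'I_m -> K) :
  (forall i j, r i j \in O) ->
  (forall j, {in A &, forall i k,
     \sum_(l in A) M i l * B j l k = \sum_j' r j' j * B j' i k}) ->
  {in A &, forall i k, (i == k)%:R = \sum_j s j * B j i k} ->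
  \sum_(i in A) M i i \in O.
Proof.
move=> rO MB sB; rewrite big_enum_val /=.
pose mx (F : I -> I -> K) :=
  \matrix_(i < #|A|, j < #|A|) F (enum_val i) (enum_val j).
have -> : \sum_(i < #|A|) M (enum_val i) (enum_val i) = \tr (mx M).
  by apply: eq_bigr => i _; rewrite mxE.
apply: (@mxtrace_integral _ _ _ (\matrix_(i, j) r i j) (fun j => mx (B j)) s).
- by move=> i j; rewrite mxE.
- move=> j; apply/matrixP=> i k; rewrite !mxE summxE.
  under eq_bigr do rewrite !mxE.
  under [RHS]eq_bigr do rewrite !mxE.
  by rewrite -MB ?enum_valP // [RHS]big_enum_val.
- apply/matrixP=> i k; rewrite !mxE summxE.
  under eq_bigr do rewrite !mxE.
  by rewrite -sB ?enum_valP // (inj_eq enum_val_inj).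
Qed.

End Integrality.

(** * Orders determined by their dual *)

(** A copy of [U] tagged by [iota], to which the [R]-module structure can be attached without
    clashing with the [K]-module structure. *)
Definition restrict_scalars (R K : comNzRingType) (iota : {rmorphism R -> K})
  (U : lmodType K) : Type := U.

Section RestrictScalars.
Variables (R K : comNzRingType) (iota : {rmorphism R -> K}) (U : lmodType K).
Local Notation UR := (restrict_scalars iota U).

HB.instance Definition _ := GRing.Zmodule.copy UR U.

Definition restrict_scale (r : R) (x : UR) : UR := iota r *: (x : U).

Fact restrict_scaleA r s x :
  restrict_scale r (restrict_scale s x) = restrict_scale (r * s) x.
Proof. by rewrite /restrict_scale scalerA rmorphM. Qed.

Fact restrict_scale1 : left_id 1 restrict_scale.
Proof. by move=> x; rewrite /restrict_scale rmorph1 scale1r. Qed.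

Fact restrict_scaleDr : right_distributive restrict_scale +%R.
Proof. by move=> r x y; apply: scalerDr. Qed.

Fact restrict_scaleDl x : {morph restrict_scale^~ x : r s / r + s}.
Proof. by move=> r s; rewrite /restrict_scale rmorphD scalerDl. Qed.

HB.instance Definition _ := GRing.Zmodule_isLmodule.Build R UR
  restrict_scaleA restrict_scale1 restrict_scaleDr restrict_scaleDl.

End RestrictScalars.

(** * Dual bases of finitely generated projective submodules *)

Section DualBasis.
Variables (R K : comNzRingType) (iota : {rmorphism R -> K}) (U : lmodType K).
Local Notation UR := (restrict_scalars iota U).
Variables (X : set U) (subX : is_submodule iota X).

Definition submodule_pred : {pred UR} := [pred x | `[<X x>]].

Fact submodule_predP : submod_closed submodule_pred.
Proof.
case: subX => X0 XD; by split=> [|r x y]; rewrite !inE //; apply: XD.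
Qed.

HB.instance Definition _ :=
  GRing.isSubmodClosed.Build R UR submodule_pred submodule_predP.

Record submodule := Submodule { submodule_val : UR;
  _ : submodule_val \in submodule_pred }.

HB.instance Definition _ := [isSub for submodule_val].
HB.instance Definition _ := [Choice of submodule by <:].
HB.instance Definition _ := [SubChoice_isSubLmodule of submodule by <:].

(** Projectivity splits the surjection from a free module onto [X]. The coordinates of the splitting
    extend from [X] to [K]-linear forms on [U] by the universal property of the isomorphism between
    [X] tensor [K] and [U]. *)
Lemma projective_dual_basis :
  finitely_generated iota X -> projective iota X ->
  is_tensor_product iota X setT (fun (x : U) (k : K^o) => k *: x) ->
  exists m (x : 'I_m -> U) (phi : 'I_m -> {scalar U}),
    [/\ forall i, X (x i), forall i y, X y -> exists r, iota r = phi i y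
      & forall y, y = \sum_i phi i y *: x i].
Proof.
move=> [m [x [Xx genX]]] projX [_ _ univ].
pose W : lmodType R := submodule; pose V : lmodType R := {ffun 'I_m -> R^o}.
have xP i : x i \in submodule_pred by rewrite inE; apply: Xx.
pose g (v : V) : W := \sum_i (v i : R) *: (Submodule (xP i) : W).
have gl : linear g.
  move=> r u v; rewrite /g scaler_sumr -big_split; apply: eq_bigr => i _.
  by rewrite !ffunE /= scalerDl scalerA.
pose gL : {linear V -> W} := HB.pack g (GRing.isLinear.Build _ _ _ _ _ gl).
have gE v : submodule_val (g v) = \sum_i iota (v i) *: x i.
  by rewrite /g; elim/big_rec2: _ => // i u w _ <-.
have Xval (w : W) : X (submodule_val w).
  by case: w => w /=; rewrite inE.
(* The value 0 outside [X] is harmless, as [linear_on] tests [p] on [X] only. *)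
pose p (y : U) : W := insubd (0 : W) (y : UR).
have pE y : X y -> submodule_val (p y) = y.
  by move=> Xy; rewrite /p [LHS]insubdK // inE.
have gsurj w : exists v, gL v = w.
  have [r rP] := genX _ (Xval w).
  by exists [ffun i => r i]; apply: val_inj; rewrite /= gE rP;
    apply: eq_bigr => i _; rewrite ffunE.
have pl : linear_on iota X p.
  move=> r y z Xy Xz; apply: val_inj.
  have XX : X (iota r *: y + z) by case: subX => _; apply.
  by apply: etrans (pE _ XX) _; rewrite -{1}(pE y Xy) -{1}(pE z Xz).
have [q [ql gq]] := projX V W gL p gsurj pl.
have [X0 XD] := subX.
pose KR : lmodType R := restrict_scalars iota K^o.
have linT (V' : lmodType R) (h : U -> V') : linear_on iota setT h ->
    {morph h : y z / y + z}.
  by move=> hl y z; have := hl 1 y z I I; rewrite rmorph1 !scale1r.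
have coord (i : 'I_m) : exists phi : {scalar U}, forall y, X y -> phi y =
  iota (q y i).
  have bil k : exists! h : U -> KR, linear_on iota setT h /\
      forall y (c : K^o), X y -> setT c -> h (c *: y) =
        k * ((c : K) * iota (q y i)).
    apply: univ => [c _ r y z Xy Xz|y Xy r c d _ _].
      rewrite ql // !ffunE rmorphD rmorphM.
      rewrite -[RHS]/(iota r * (k * ((c : K) * iota (q y i))) + k *
        ((c : K) * iota (q z i))).
      by ring.
    rewrite -[RHS]/(iota r * (k * ((c : K) * iota (q y i))) + k *
      ((d : K) * iota (q y i))).
    by rewrite -[iota r *: c + d]/(iota r * (c : K) + d); ring.
  have [h [[hl hb] _]] := bil 1.
  (* The maps [h (k *: y)] and [k * h y] both extend the bilinear map with parameter [k]; uniqueness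
     makes [h], so far only [R]-linear, homogeneous over [K]. *)
  have hZ k y : h (k *: y) = (k : K) * (h y : K).
    have [h' [_ uniq]] := bil k.
    have h0 : h 0 = 0 by apply: (addIr (h 0)); rewrite -(linT _ _ hl) !add0r.
    have E1 : h' = (fun y => h (k *: y)).
      apply: uniq; split=> [r u v _ _|u c Xu _]; last by rewrite scalerA hb //;
        ring.
      rewrite scalerDr (linT _ _ hl) scalerA mulrC -scalerA.
      by have := hl r (k *: u) 0 I I; rewrite h0 !addr0 => ->.
    have E2 : h' = (fun y => (k : K) * (h y : K)).
      apply: uniq; split=> [r u v _ _|u c Xu _]; last by rewrite hb //; ring.
      rewrite hl // -[RHS]/(iota r * (k * (h u : K)) + k * (h v : K)).
      by rewrite -[r *: h u + h v]/(iota r * (h u : K) + h v); ring.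
    by rewrite -[LHS]/((fun y => h (k *: y)) y) -E1 E2.
  have hlin : scalar (h : U -> K) by move=> k y z; rewrite (linT _ _ hl) hZ.
  pose hL : {scalar U} := HB.pack (h : U -> K)
    (GRing.isLinear.Build _ _ _ _ _ hlin).
  exists hL => y Xy /=.
  by have := hb y 1 Xy I; rewrite scale1r !mul1r.
have [phi phiE] := choice coord.
exists m, x, phi; split => // [i y Xy|y]; first by exists (q y i); rewrite phiE.
(* Uniqueness again: the identity and the expansion along the [x i] both extend the map from
   [(x, k)] to [k *: x], so they agree on all of [U]. *)
pose UR' : lmodType R := restrict_scalars iota U.
have [||h [_ uniq]] := univ UR' (fun (x : U) (k : K^o) => k *: x).
- by move=> c _ r u v _ _ /=; rewrite scalerDr scalerA mulrC -scalerA.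
- by move=> u _ r c d _ _ /=; rewrite scalerDl -scalerA.
have E1 : h = id by apply: uniq; split.
have E2 : h = (fun y => \sum_i phi i y *: x i).
  apply: uniq; split=> [r u v _ _|u c Xu _].
    rewrite scaler_sumr -big_split; apply: eq_bigr => i _.
    by rewrite linearP scalerDl /= -scalerA.
  rewrite -{2}(pE u Xu) -gq // gE scaler_sumr; apply: eq_bigr => i _.
  by rewrite linearZ /= -scalerA phiE.
by rewrite -[LHS]/(id y) -E1 E2.
Qed.

End DualBasis.

Section ScalarFunctions.
Variables (K : comNzRingType) (U : lmodType K) (phi : U -> K).
Hypothesis phiP : scalar phi.

Let phiL : {scalar U} := HB.pack phi (GRing.isLinear.Build _ _ _ _ _ phiP).

Lemma scalarZ k x : phi (k *: x) = k * phi x.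
Proof. exact: (linearZ_LR phiL). Qed.

Lemma scalar_sum (I : Type) (s : seq I) (P : pred I) (F : I -> U) :
  phi (\sum_(i <- s | P i) F i) = \sum_(i <- s | P i) phi (F i).
Proof. exact: (linear_sum phiL). Qed.

Lemma scalar_sumZ (I : Type) (s : seq I) (P : pred I)
    (c : I -> K) (x : I -> U) :
  phi (\sum_(i <- s | P i) c i *: x i) = \sum_(i <- s | P i) c i * phi (x i).
Proof. by rewrite scalar_sum; apply: eq_bigr => i _; rewrite scalarZ. Qed.

End ScalarFunctions.

(** * Orders with a dual basis: membership, eigenvalues and traces *)

Section ReflexiveOrder.
Variables (K : fieldExtType rat) (A : algType K).
Local Notation O := (@algebraic_integer K).
Implicit Types (Z : set A) (x y z : A).

(** These functionals form the dual order of [Z]. *)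
Definition integral_on Z (phi : A -> K) :=
  scalar phi /\ forall z, Z z -> phi z \in O.

(** The dual basis in the last clause condenses finite generation, projectivity and the condition
    that [Z] spans [A]. *)
Definition reflexive_order Z :=
  [/\ forall k x y, k \in O -> Z x -> Z y -> Z (k *: x + y), Z 1,
      forall x y, Z x -> Z y -> Z (x * y)
    & exists m (b : 'I_m -> A) (phi : 'I_m -> A -> K),
        [/\ forall i, Z (b i), forall i, integral_on Z (phi i)
          & forall y, y = \sum_i phi i y *: b i]].

Variable Z : set A.
Hypothesis orderZ : reflexive_order Z.

Lemma in_order1 : Z 1. Proof. by case: orderZ. Qed.

Lemma in_orderM x y : Z x -> Z y -> Z (x * y).
Proof. by case: orderZ => _ _ + _; apply. Qed.

Lemma in_orderX x n : Z x -> Z (x ^+ n).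
Proof.
move=> Zx; elim: n => [|n IHn]; first by rewrite expr0; apply: in_order1.
by rewrite exprS; apply: in_orderM.
Qed.

Lemma in_order0 : Z 0.
Proof.
case: orderZ => Zl Z1 _ _; rewrite -(addNr (1 : A)) -scaleN1r.
by apply: Zl => //; rewrite rpredN rpred1.
Qed.

Lemma in_orderD x y : Z x -> Z y -> Z (x + y).
Proof.
by case: orderZ => Zl _ _ _ Zx Zy; rewrite -[x]scale1r; apply: Zl;
  rewrite ?rpred1.
Qed.

Lemma in_orderZr k x : k \in O -> Z x -> Z (k *: x).
Proof. by case: orderZ => Zl _ _ _ kO Zx; rewrite -[_ *: x]addr0;
  apply: Zl in_order0. Qed.

Lemma in_orderB x y : Z x -> Z y -> Z (x - y).
Proof.
by move=> Zx Zy; rewrite -scaleN1r; apply/in_orderD/in_orderZr;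
  rewrite // rpredN rpred1.
Qed.

Lemma in_order_sum (I : Type) (s : seq I) (P : pred I) (F : I -> A) :
  (forall i, P i -> Z (F i)) -> Z (\sum_(i <- s | P i) F i).
Proof. by move=> ZF; elim/big_ind: _ => //;
  [apply: in_order0 | apply: in_orderD]. Qed.

(** The coordinates of [x] in the dual basis are values of elements of the dual order, so [Z] is its
    own bidual. *)
Lemma mem_order x : (forall phi, integral_on Z phi -> phi x \in O) -> Z x.
Proof.
move=> xO; case: orderZ => _ _ _ [m [b [phi [Zb phiP bP]]]].
by rewrite (bP x); apply: in_order_sum => i _; apply: in_orderZr => //;
  apply: xO.
Qed.

(** Left multiplication by [x] has the integral matrix [phi i (x * b j)], for which the coordinates
    of [h] form an eigenvector. The vector [h] may lie outside [Z]. *)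
Lemma order_eigenvalue x h t : Z x -> h != 0 -> x * h = t *: h -> t \in O.
Proof.
move=> Zx h0 xh; case: orderZ => _ _ _ [m [b [phi [Zb phiP bP]]]].
apply: (@eigenvalue_integral _ _ (\matrix_(j, i) phi i (x * b j))).
  by move=> i j; rewrite mxE; apply: (phiP _).2; apply: in_orderM.
apply/eigenvalueP; exists (\row_i phi i h).
  apply/rowP=> i; rewrite !mxE.
  transitivity (phi i (x * h)).
    rewrite {2}(bP h) mulr_sumr; under [in RHS]eq_bigr do rewrite -scalerAr.
    by rewrite (scalar_sumZ (phiP i).1); apply: eq_bigr => j _; rewrite !mxE.
  by rewrite xh (scalarZ (phiP i).1).
apply: contraNneq h0 => /rowP phi0; rewrite (bP h) big1 // => i _.
by have := phi0 i; rewrite !mxE => ->; rewrite scale0r.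
Qed.

(** The matrices [rho (b j)] have the identity in their span and are permuted by [rho x] up to the
    integral coefficients [phi i (x * b j)]. *)
Lemma order_trace (I : finType) (S : {set I}) (rho : I -> I -> A -> K) x :
  (forall i k, scalar (rho i k)) ->
  {in S &, forall i k y z,
     rho i k (y * z) = \sum_(l in S) rho i l y * rho l k z} ->
  {in S &, forall i k, rho i k 1 = (i == k)%:R} ->
  Z x -> \sum_(i in S) rho i i x \in O.
Proof.
move=> rhoL rhoM rho1 Zx; case: orderZ => _ Z1 _ [m [b [phi [Zb phiP bP]]]].
apply: (@trace_integral _ _ _ (fun i k => rho i k x) _
  (fun i j => phi i (x * b j)) (fun j i k => rho i k (b j)) (fun j => phi j 1)).
- by move=> i j; apply: (phiP _).2; apply: in_orderM.
- by move=> j i k iS kS; rewrite -rhoM // {1}(bP (x * b j)) scalar_sumZ.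
- by move=> i k iS kS; rewrite -rho1 // {1}(bP 1) scalar_sumZ.
Qed.

End ReflexiveOrder.

(** * Group algebras *)

Section GroupAlgebraBasics.
Variables (K : fieldType) (gT : finGroupType).
Local Notation KG := (galg K gT).
Local Notation KG2 := (galg K (gT * gT)%type).
Implicit Types (u v : KG) (phi psi : KG -> K) (g h : gT).

Lemma galgDE u v g : (u + v) g = u g + v g. Proof. by rewrite ffunE. Qed.
Lemma galgZE k u g : (k *: u) g = k * (u g : K). Proof. by rewrite ffunE. Qed.
Lemma galg_sumE (I : Type) (s : seq I) (P : pred I) (F : I -> KG) g :
  (\sum_(i <- s | P i) F i) g = \sum_(i <- s | P i) F i g.
Proof. by rewrite sum_ffunE. Qed.

Lemma gbase1 : gbase K (1 : gT) = 1 :> KG. Proof. by []. Qed.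

Lemma gbaseVr g : gbase K g * gbase K g^-1 = 1.
Proof. by rewrite gbaseM mulgV. Qed.

Lemma gbaseVl g : gbase K g^-1 * gbase K g = 1.
Proof. by rewrite gbaseM mulVg. Qed.

End GroupAlgebraBasics.

Section GroupAlgebraFacts.
Variables (K : fieldType) (gT : finGroupType).
Local Notation KG := (galg K gT).
Local Notation KG2 := (galg K (gT * gT)%type).
Implicit Types (u v : KG) (w : KG2) (phi psi : KG -> K) (g h : gT).

Lemma gtensZl k u x : gtens (k *: u) x = k *: gtens u x.
Proof. by apply/ffunP=> p; rewrite !(galgZE, ffunE) /= mulrA. Qed.
Lemma gtensZr k u x : gtens x (k *: u) = k *: gtens x u.
Proof. by apply/ffunP=> p; rewrite !(galgZE, ffunE) /= mulrCA. Qed.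
Lemma gtens_suml (I : Type) (s : seq I) (P : pred I) (F : I -> KG) x :
  gtens (\sum_(i <- s | P i) F i) x = \sum_(i <- s | P i) gtens (F i) x.
Proof. by apply/ffunP=> p; rewrite galg_sumE ffunE galg_sumE mulr_suml;
  apply: eq_bigr => i _; rewrite ffunE. Qed.
Lemma gtens_sumr (I : Type) (s : seq I) (P : pred I) (F : I -> KG) x :
  gtens x (\sum_(i <- s | P i) F i) = \sum_(i <- s | P i) gtens x (F i).
Proof. by apply/ffunP=> p; rewrite galg_sumE ffunE galg_sumE mulr_sumr;
  apply: eq_bigr => i _; rewrite ffunE. Qed.

Lemma gtensM u v u' v' : gtens u v * gtens u' v' = gtens (u * u') (v * v').
Proof.
apply/ffunP=> p; rewrite !ffunE /= big_distrlr pair_big /=.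
by apply: eq_bigr => -[y z] _; rewrite !ffunE /= mulrACA.
Qed.

Lemma gtens11 : gtens 1 1 = 1 :> KG2.
Proof. by rewrite -!gbase1 gtens_base. Qed.

Lemma galg_scalar phi u : scalar phi -> phi u =
  \sum_g (u g : K) * phi (gbase K g).
Proof. by move=> phiP; rewrite {1}[u]galg_sum scalar_sumZ. Qed.

Lemma galg_eq_linear (V : lmodType K) (f f' : KG -> V) :
  linear f -> linear f' -> (forall g, f (gbase K g) = f' (gbase K g)) ->
    f =1 f'.
Proof.
move=> fl fl' ff' u.
pose F : {linear KG -> V} := HB.pack f (GRing.isLinear.Build _ _ _ _ _ fl).
pose F' : {linear KG -> V} := HB.pack f' (GRing.isLinear.Build _ _ _ _ _ fl').
rewrite -[f u]/(F u) -[f' u]/(F' u) [u]galg_sum !linear_sum.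
by apply: eq_bigr => g _; rewrite !linearZ /= ff'.
Qed.

Lemma gcomul_linear : linear (@gcomul K gT).
Proof.
move=> k u v; rewrite /gcomul scaler_sumr -big_split; apply: eq_bigr => g _.
by rewrite galgDE galgZE scalerDl scalerA.
Qed.
HB.instance Definition _ :=
  GRing.isLinear.Build _ _ _ _ (@gcomul K gT) gcomul_linear.

Lemma gcomul_base g : gcomul (gbase K g) = gtens (gbase K g) (gbase K g).
Proof.
rewrite gtens_base /gcomul (bigD1 g) //= big1 => [|h /negPf hg].
  by rewrite ffunE eqxx scale1r addr0.
by rewrite ffunE hg scale0r.
Qed.

Lemma gcounit_scalar : scalar (@gcounit K gT).
Proof.
move=> k u v; rewrite /gcounit mulr_sumr -big_split; apply: eq_bigr => g _.
by rewrite galgDE galgZE.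
Qed.
HB.instance Definition _ :=
  GRing.isLinear.Build _ _ _ _ (@gcounit K gT) gcounit_scalar.

Lemma gcounit_base g : gcounit (gbase K g) = 1.
Proof.
rewrite /gcounit (bigD1 g) //= big1 => [|h /negPf hg];
  first by rewrite ffunE eqxx addr0.
by rewrite ffunE hg.
Qed.

Lemma gantipode_linear : linear (@gantipode K gT).
Proof.
move=> k u v; rewrite /gantipode scaler_sumr -big_split; apply: eq_bigr => g _.
by rewrite galgDE galgZE scalerDl scalerA.
Qed.
HB.instance Definition _ :=
  GRing.isLinear.Build _ _ _ _ (@gantipode K gT) gantipode_linear.

Lemma gantipode_base g : gantipode (gbase K g) = gbase K g^-1.
Proof.
rewrite /gantipode (bigD1 g) //= big1 => [|h /negPf hg];
  first by rewrite ffunE eqxx scale1r addr0.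
by rewrite ffunE hg scale0r.
Qed.

Lemma bilinear_eq (V : lmodType K) (f f' : KG -> KG -> V) :
  (forall x, linear (f x)) -> (forall x, linear (f^~ x)) ->
  (forall x, linear (f' x)) -> (forall x, linear (f'^~ x)) ->
  (forall g h, f (gbase K g) (gbase K h) = f' (gbase K g) (gbase K h)) ->
  forall x y, f x y = f' x y.
Proof.
move=> fr fl fr' fl' ff' x y; apply: (galg_eq_linear (fl y) (fl' y)) => g.
by apply: (galg_eq_linear (fr _) (fr' _)) => h.
Qed.

Lemma gcomulM u v : gcomul (u * v) = gcomul u * gcomul v.
Proof.
apply: (bilinear_eq (f := fun u v => gcomul (u * v)) (f' :=
  fun u v => gcomul u * gcomul v)) => [x|x|x|x|g h] =>
  [k y z|k y z|k y z|k y z|].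
- by rewrite mulrDr -scalerAr linearP.
- by rewrite mulrDl -scalerAl linearP.
- by rewrite linearP mulrDr -scalerAr.
- by rewrite linearP mulrDl -scalerAl.
- by rewrite gbaseM !gcomul_base gtensM gbaseM.
Qed.

Lemma gcomul1 : gcomul (1 : KG) = 1.
Proof. by rewrite -gbase1 gcomul_base gtens11. Qed.

Lemma gcounitM u v : gcounit (u * v) = gcounit u * gcounit v.
Proof.
apply: (bilinear_eq (V := K^o) (f := fun u v => gcounit (u * v)) (f' :=
  fun u v => gcounit u * gcounit v)) => [x|x|x|x|g h] =>
  [k y z|k y z|k y z|k y z|].
- by rewrite mulrDr -scalerAr linearP.
- by rewrite mulrDl -scalerAl linearP.
- by rewrite linearP mulrDr mulrCA.
- by rewrite linearP mulrDl -mulrA.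
- by rewrite gbaseM !gcounit_base mulr1.
Qed.

Lemma gantipodeM u v : gantipode (u * v) = gantipode v * gantipode u.
Proof.
apply: (bilinear_eq (f := fun u v => gantipode (u * v)) (f' :=
  fun u v => gantipode v * gantipode u)) => [x|x|x|x|g h] =>
  [k y z|k y z|k y z|k y z|].
- by rewrite mulrDr -scalerAr linearP.
- by rewrite mulrDl -scalerAl linearP.
- by rewrite linearP mulrDl -scalerAl.
- by rewrite linearP mulrDr -scalerAr.
- by rewrite gbaseM !gantipode_base gbaseM invMg.
Qed.

(** For linear [phi] and [psi] this is the functional phi (x) psi on the tensor square. *)
Definition ftens phi psi w :=
  \sum_p (w p : K) * (phi (gbase K p.1) * psi (gbase K p.2)).

Lemma ftens_scalar phi psi : scalar (ftens phi psi).
Proof.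
move=> k w w'; rewrite /ftens mulr_sumr -big_split; apply: eq_bigr => p _.
by rewrite galgDE galgZE mulrDl -mulrA.
Qed.

Lemma ftensE phi psi u v : scalar phi -> scalar psi ->
  ftens phi psi (gtens u v) = phi u * psi v.
Proof.
move=> phiP psiP; rewrite (galg_scalar u phiP)
  (galg_scalar v psiP) big_distrlr pair_big /=.
by apply: eq_bigr => -[g h] _; rewrite ffunE /= mulrACA.
Qed.

(** For linear [phi] this is the map phi (x) id. *)
Definition contract phi w : KG :=
  \sum_p ((w p : K) * phi (gbase K p.1)) *: gbase K p.2.

Lemma contract_linear phi : linear (contract phi).
Proof.
move=> k w w'; rewrite /contract scaler_sumr -big_split; apply: eq_bigr => p _.
by rewrite galgDE galgZE mulrDl scalerDl scalerA mulrA.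
Qed.
HB.instance Definition _ phi :=
  GRing.isLinear.Build _ _ _ _ (contract phi) (contract_linear phi).

Lemma contractE phi u v : scalar phi -> contract phi (gtens u v) = phi u *: v.
Proof.
move=> phiP; rewrite (galg_scalar u phiP) {2}[v]galg_sum scaler_sumr.
under [RHS]eq_bigr do rewrite scaler_suml.
rewrite exchange_big pair_big /=; apply: eq_bigr => -[g h] _.
by rewrite ffunE /= scalerA mulrAC.
Qed.

End GroupAlgebraFacts.

(** * The tensor square of an order and the algebra structure of its dual *)

Section OrderTensor.
Variables (K : fieldExtType rat) (gT : finGroupType).
Local Notation KG := (galg K gT).
Local Notation KG2 := (galg K (gT * gT)%type).
Local Notation O := (@algebraic_integer K).
Implicit Types (Z : set KG) (u v : KG) (w : KG2).

(** The image of [Z] tensor [Z], stated apart from any Hopf structure so that it serves both the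
    twisted and the untwisted coproduct. *)
Definition order_square Z : set KG2 :=
  [set w | exists n (a b : 'I_n -> KG),
    [/\ forall i, Z (a i), forall i, Z (b i) & w = \sum_i gtens (a i) (b i)]].

Variable Z : set KG.
Hypothesis orderZ : reflexive_order Z.
Local Notation ZZ := (order_square Z).

Lemma order_square_gtens u v : Z u -> Z v -> ZZ (gtens u v).
Proof.
by move=> Zu Zv; exists 1%N, (fun=> u), (fun=> v); split=> //; rewrite big_ord1.
Qed.

Lemma order_squareD w w' : ZZ w -> ZZ w' -> ZZ (w + w').
Proof.
move=> [n [a [b [Za Zb ->]]]] [m [c [d [Zc Zd ->]]]].
pose F (T : Type) (f : 'I_n -> T) (g : 'I_m -> T) (i : 'I_(n + m)) :=
  match fintype.split i with inl j => f j | inr j => g j end.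
have FZ f g : (forall i, Z (f i)) -> (forall i, Z (g i)) ->
  forall i, Z (F _ f g i).
  by move=> Zf Zg i; rewrite /F; case: fintype.split.
exists (n + m)%N, (F _ a c), (F _ b d); split; [exact: FZ | exact: FZ |].
rewrite big_split_ord; congr (_ + _); apply: eq_bigr => i _; rewrite /F.
  by rewrite -[lshift m i]/(unsplit (inl i)) unsplitK.
by rewrite -[rshift n i]/(unsplit (inr i)) unsplitK.
Qed.

Lemma order_square_sum (I : Type) (s : seq I) (P : pred I) (F : I -> KG2) :
  (forall i, P i -> ZZ (F i)) -> ZZ (\sum_(i <- s | P i) F i).
Proof.
move=> ZF; elim/big_ind: _ => //; last exact: order_squareD.
by exists 0%N, (fun=> 0), (fun=> 0); rewrite big_ord0; split=> // -[].
Qed.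

Lemma order_squareM w w' : ZZ w -> ZZ w' -> ZZ (w * w').
Proof.
move=> [n [a [b [Za Zb ->]]]] [m [c [d [Zc Zd ->]]]].
rewrite big_distrlr; apply: order_square_sum => i _;
  apply: order_square_sum => j _.
by rewrite /= gtensM; apply: order_square_gtens; apply: (in_orderM orderZ).
Qed.

Lemma order_squareZ k w : k \in O -> ZZ w -> ZZ (k *: w).
Proof.
move=> kO [n [a [b [Za Zb ->]]]]; rewrite scaler_sumr.
apply: order_square_sum => i _; rewrite -gtensZl;
  apply: order_square_gtens => //.
exact: in_orderZr.
Qed.

Lemma contract_order phi w : integral_on Z phi -> ZZ w -> Z (contract phi w).
Proof.
move=> [phil phiO] [n [a [b [Za Zb ->]]]]; rewrite linear_sum.
apply: (in_order_sum orderZ) => i _; rewrite /= contractE //.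
by apply: (in_orderZr orderZ) => //; apply: phiO.
Qed.

Lemma ftens_order phi psi w :
  integral_on Z phi -> integral_on Z psi -> ZZ w -> ftens phi psi w \in O.
Proof.
move=> [phil phiO] [psil psiO] [n [a [b [Za Zb ->]]]].
rewrite (scalar_sum (ftens_scalar _ _)); apply: rpred_sum => i _.
by rewrite ftensE // rpredM ?phiO ?psiO.
Qed.

Variable D : KG -> KG2.
Hypotheses (Dlin : linear D) (ZD : forall z, Z z -> ZZ (D z)).

(** The dual order is closed under the product dual to [D], because [D] maps [Z] into the square of
    [Z]. *)
Lemma convolution_integral phi psi : integral_on Z phi -> integral_on Z psi ->
  integral_on Z (fun x => ftens phi psi (D x)).
Proof.
move=> phiP psiP; split=> [k x y|z Zz]; last by apply: ftens_order => //;
  apply: ZD.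
by rewrite Dlin ftens_scalar.
Qed.

(* For [phi] in the dual order, [phi (T i k)] is the matrix of [phi] in a
   representation of the dual algebra, hence its trace is integral. *)
Lemma comatrix_trace_order (I : finType) (S : {set I}) (T : I -> I -> KG) :
  {in S &, forall i k, D (T i k) = \sum_(l in S) gtens (T i l) (T l k)} ->
  {in S &, forall i k, gcounit (T i k) = (i == k)%:R} ->
  Z (\sum_(i in S) T i i).
Proof.
move=> TD Te; apply: (mem_order orderZ) => phi phiP.
case: (orderZ) => _ _ _ [m [b [psi [Zb psiP bP]]]].
rewrite (scalar_sum phiP.1).
(* The counit acts as the identity matrix, so its values on the [b j] are the coefficients of the
   identity. *)
apply: (@trace_integral _ _ _ (fun i k => phi (T i k)) _
  (fun i j => ftens phi (psi j) (D (b i))) (fun j i k => psi j (T i k))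
  (fun j => gcounit (b j))).
- by move=> i j; apply: (convolution_integral phiP (psiP j)).2.
- move=> j i k iS kS.
  have cl := (convolution_integral phiP (psiP j)).1.
  transitivity (ftens phi (psi j) (D (T i k))).
    rewrite TD // (scalar_sum (ftens_scalar _ _)); apply: eq_bigr => l _.
    by rewrite (ftensE _ _ phiP.1 (psiP j).1).
  rewrite {1}(bP (T i k)) (scalar_sumZ cl).
  by apply: eq_bigr => l _; rewrite mulrC.
- move=> i k iS kS; rewrite -Te // {1}(bP (T i k)).
  rewrite (scalar_sumZ (@gcounit_scalar _ _)).
  by apply: eq_bigr => l _; rewrite mulrC.
Qed.

(** A group-like element spans a matrix coalgebra of size one and is its own character. *)
Lemma grouplike_order x : D x = gtens x x -> gcounit x = 1 -> Z x.
Proof.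
move=> Dx ex; have := @comatrix_trace_order _ [set tt] (fun _ _ => x).
by rewrite !big_set1; apply=> [[] []|[] []] _ _.
Qed.

End OrderTensor.

(** * The permutation module on the cosets of Q *)

Section CosetModule.
Variables (gT : finGroupType) (N Q : {group gT}).
Hypothesis hG : (N ><| Q)%g = [set: gT]%SET.

Lemma sdprod_split (g : gT) : exists n q, [/\ n \in N, q \in Q & g = (n * q)%g].
Proof.
have [_ mNQ _ _] := sdprodP hG; have : g \in (N * Q)%g by rewrite mNQ inE.
by move=> /mulsgP[n q nN qQ ->]; exists n, q.
Qed.

Lemma sdprod_norm q : q \in Q -> q \in 'N(N)%g.
Proof. by have [_ _ + _] := sdprodP hG; move=> /fintype.subsetP/(_ q). Qed.

Lemma sdprod_memJ q x : q \in Q -> ((x ^ q)%g \in N) = (x \in N).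
Proof. by move=> /sdprod_norm qN; rewrite memJ_norm. Qed.

Lemma sdprod_TI x : x \in N -> x \in Q -> x = 1%g.
Proof.
have [_ _ _ tiNQ] := sdprodP hG; move=> xN xQ.
by apply/set1gP; rewrite -tiNQ inE xN.
Qed.

Variable K : fieldExtType rat.
Local Notation KG := (galg K gT).
Local Notation O := (@algebraic_integer K).

(* Matrix coefficients of the permutation module [K[G/Q]], the elements of [N]
   being representatives of the cosets. *)
Definition coset_coef (n n' : gT) (x : KG) : K :=
  \sum_g (x g : K) * ((n^-1 * g * n')%g \in Q)%:R.

Definition coset_trace x := \sum_(n in N) coset_coef n n x.

Lemma coset_coef_scalar n n' : scalar (coset_coef n n').
Proof.
move=> k x y; rewrite /coset_coef mulr_sumr -big_split; apply: eq_bigr => g _.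
by rewrite galgDE galgZE mulrDl -mulrA.
Qed.

Lemma coset_coef_base n n' g : coset_coef n n' (gbase K g) =
  ((n^-1 * g * n')%g \in Q)%:R.
Proof.
rewrite /coset_coef (bigD1 g) //= big1 => [|h /negPf hg];
  rewrite ffunE ?hg ?mul0r //.
by rewrite eqxx mul1r addr0.
Qed.

Lemma coset_trace_scalar : scalar coset_trace.
Proof.
move=> k x y; rewrite /coset_trace mulr_sumr -big_split; apply: eq_bigr => n _.
exact: coset_coef_scalar.
Qed.

Lemma coset_coefM : {in N &, forall n n' x y,
  coset_coef n n' (x * y) = \sum_(l in N) coset_coef n l x * coset_coef l n' y}.
Proof.
move=> n n' nN n'N x y.
apply: (bilinear_eq (V := K^o) (f := fun x y => coset_coef n n' (x * y))
    (f' := fun x y => \sum_(l in N) coset_coef n l x * coset_coef l n' y))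
  => [z|z|z|z|g h] => [k u v|k u v|k u v|k u v|].
- by rewrite mulrDr -scalerAr coset_coef_scalar.
- by rewrite mulrDl -scalerAl coset_coef_scalar.
- rewrite scaler_sumr -big_split; apply: eq_bigr => l _.
  by rewrite coset_coef_scalar mulrDr mulrCA.
- rewrite scaler_sumr -big_split; apply: eq_bigr => l _.
  by rewrite coset_coef_scalar mulrDl -mulrA.
rewrite gbaseM coset_coef_base.
(* The coset of [h * n'] has exactly one representative [l] in [N], and only its term survives. *)
have [l [q [lN qQ hn']]] := sdprod_split (h * n').
rewrite (bigD1 l) //= big1 ?addr0 => [|l' /andP[l'N l'l]].
  rewrite !coset_coef_base -[(l^-1 * h * n')%g]mulgA hn' mulKg qQ mulr1.
  by rewrite mulgA -[(_ * h * n')%g]mulgA hn' !mulgA groupMr.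
rewrite !coset_coef_base -[(l'^-1 * h * n')%g]mulgA hn' mulgA
  (groupMr (l'^-1 * l)%g qQ).
case: (boolP ((l'^-1 * l)%g \in Q)) => [lQ|_]; last by rewrite mulr0.
case/eqP: l'l; apply: (mulgI l'^-1%g); rewrite mulVg;
  apply/esym/sdprod_TI => //.
by rewrite groupM ?groupV.
Qed.

Lemma coset_coef1 : {in N &, forall n n', coset_coef n n' 1 = (n == n')%:R}.
Proof.
move=> n n' nN n'N; rewrite -gbase1 coset_coef_base mulg1; congr (_ _)%:R.
apply/idP/eqP=> [nn'|->]; last by rewrite mulVg group1.
by apply: (mulgI n^-1%g); rewrite mulVg; apply/esym/sdprod_TI => //;
  rewrite groupM ?groupV.
Qed.

Lemma coset_traceC x y : coset_trace (x * y) = coset_trace (y * x).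
Proof.
rewrite /coset_trace; under eq_bigr => n nN do rewrite coset_coefM //.
under [RHS]eq_bigr => n nN do rewrite coset_coefM //.
rewrite exchange_big; apply: eq_bigr => n _; apply: eq_bigr => l _.
exact: mulrC.
Qed.

Lemma coset_trace_integral (Z : set KG) : reflexive_order Z ->
  integral_on Z coset_trace.
Proof.
move=> orderZ; split=> [|z Zz]; first exact: coset_trace_scalar.
apply: (@order_trace _ _ _ orderZ _ _ coset_coef) Zz.
- exact: coset_coef_scalar.
- exact: coset_coefM.
- exact: coset_coef1.
Qed.

(** The trace counts the cosets m Q fixed by n q. Such a coset gives an element m^-1 n (q m q^-1) of
    both [N] and [Q], which is therefore 1. *)
Lemma coset_trace_base n q : n \in N -> q \in Q ->
  coset_trace (gbase K (n * q)) = \sum_(m in N) (n == m * (m^-1) ^ q^-1)%g%:R.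
Proof.
move=> nN qQ; apply: eq_bigr => m mN; rewrite coset_coef_base; congr (_ _)%:R.
have -> : (m^-1 * (n * q) * m = (m^-1 * n * m ^ q^-1) * q)%g.
  by rewrite conjgE invgK !mulgA mulgKV.
rewrite groupMr //; apply/idP/eqP => [mQ|->]; last first.
  by rewrite mulKg conjVg mulVg group1.
apply: (mulIg (m ^ q^-1)%g); rewrite conjVg mulgKV.
apply: (mulgI m^-1%g); rewrite mulVg mulgA; apply: sdprod_TI => //.
have mqN : (m ^ q^-1)%g \in N by rewrite sdprod_memJ ?groupV.
by apply: groupM mqN; apply: groupM nN; rewrite groupV.
Qed.

End CosetModule.

(** * Characters *)

Section CharacterTheory.
Variables (K : fieldExtType rat) (gT : finGroupType).
Implicit Types (A : {group gT}) (chi psi : {ffun gT -> K}).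
Local Notation KG := (galg K gT).
Local Notation e A chi := (char_idem A chi : KG).

Lemma natf_neq0 n : (0 < n)%N -> n%:R != 0 :> K.
Proof.
by rewrite lt0n => n0; rewrite -[n%:R](rmorph_nat (in_alg K)) fmorph_eq0
  pnatr_eq0.
Qed.

Lemma cardG_neq0 A : #|A|%:R != 0 :> K. Proof. exact/natf_neq0/cardG_gt0. Qed.

Definition dual_mul chi psi : {ffun gT -> K} := [ffun x => chi x * psi x].
Definition dual_inv chi : {ffun gT -> K} := [ffun x => chi x^-1%g].

Section OneGroup.
Variable A : {group gT}.

Lemma dual_at1 chi : dual A chi -> chi 1%g = 1.
Proof.
move=> [chiM chi0 _]; apply: (mulfI (chi0 _ (group1 A))).
by rewrite -chiM ?group1 // mulg1 mulr1.
Qed.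

Lemma dualV chi a : dual A chi -> a \in A -> chi a^-1%g = (chi a)^-1.
Proof.
move=> chiP aA; case: (chiP) => chiM chi0 _; apply: (mulfI (chi0 _ aA)).
by rewrite -chiM ?groupV // mulgV dual_at1 // mulfV // chi0.
Qed.

Lemma dual_trivial : dual A (trivial_char K A).
Proof.
split=> [x y xA yA|x xA|x /negPf xA]; rewrite !ffunE ?groupM ?xA ?yA ?mulr1 //.
exact: oner_neq0.
Qed.

Lemma dual_mulP chi psi : dual A chi -> dual A psi -> dual A (dual_mul chi psi).
Proof.
move=> [chiM chi0 chi1] [psiM psi0 psi1]; split=> [x y xA yA|x xA|x xA];
  rewrite !ffunE.
- by rewrite chiM // psiM // mulrACA.
- by rewrite mulf_neq0 ?chi0 ?psi0.
- by rewrite chi1 // mul0r.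
Qed.

Lemma dual_orthogonality chi psi : dual A chi -> dual A psi ->
  \sum_(a in A) chi a * psi a^-1%g = if chi == psi then #|A|%:R else 0.
Proof.
move=> chiP psiP; case: eqP => [<-|neq].
  rewrite (eq_bigr (fun=> 1)) ?sumr_const // => a aA.
  by rewrite dualV // mulfV //; case: chiP => _ ->.
have [b bA chib] : exists2 b, b \in A & chi b != psi b.
  apply: contrapT => no; apply: neq; apply/ffunP=> x.
  case: (boolP (x \in A)) => xA; last first.
    by case: chiP psiP => _ _ -> // [_ _ ->].
  by apply/eqP/negPn/negP=> cx; apply: no; exists x.
set S := \sum_(a in A) _; apply/eqP.
(* Translating the summation variable by [b] multiplies the sum by a factor different from 1. *)
have : chi b * psi b^-1%g * S = S.
  rewrite {2}/S (reindex_inj (mulgI b)) /= mulr_sumr.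
  rewrite [RHS](eq_bigl (fun a => a \in A)); last by move=> a; rewrite groupMl.
  apply: eq_bigr => a aA; case: chiP psiP => chiM _ _ [psiM _ _].
  by rewrite invMg chiM // psiM ?groupV // [psi a^-1%g * _]mulrC mulrACA.
move/eqP; rewrite -subr_eq0 -{2}[S]mul1r -mulrBl mulf_eq0 => /orP[|//].
rewrite dualV // subr_eq0 => /eqP E; case/eqP: chib.
have p0 : psi b != 0 by case: psiP => _ ->.
by apply: (mulIf (invr_neq0 p0)); rewrite E mulfV.
Qed.

Lemma char_idemMl chi a : dual A chi -> a \in A ->
  gbase K a * e A chi = chi a *: e A chi.
Proof.
move=> chiP aA; rewrite -scalerAr scalerA mulrC -scalerA; congr (_ *: _).
rewrite mulr_sumr scaler_sumr (reindex_inj (mulgI a^-1%g)) /=.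
rewrite (eq_bigl (fun a => a \in A)); last by move=> b; rewrite groupMl ?groupV.
apply: eq_bigr => b bA; rewrite -scalerAr gbaseM mulKVg scalerA; congr (_ *: _).
by case: chiP => chiM _ _; rewrite invMg invgK mulrC chiM ?groupV.
Qed.

Lemma char_idemMr chi a : dual A chi -> a \in A ->
  e A chi * gbase K a = chi a *: e A chi.
Proof.
move=> chiP aA; rewrite -scalerAl scalerA mulrC -scalerA; congr (_ *: _).
rewrite mulr_suml scaler_sumr (reindex_inj (mulIg a^-1%g)) /=.
rewrite (eq_bigl (fun a => a \in A)); last by move=> b; rewrite groupMr ?groupV.
apply: eq_bigr => b bA; rewrite -scalerAl gbaseM mulgKV scalerA; congr (_ *: _).
by case: chiP => chiM _ _; rewrite invMg invgK chiM ?groupV.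
Qed.

Lemma char_idemM chi psi : dual A chi -> dual A psi ->
  e A chi * e A psi = if chi == psi then e A chi else 0.
Proof.
move=> chiP psiP; rewrite {1}/char_idem -scalerAl mulr_suml.
under eq_bigr => a aA do rewrite -scalerAl char_idemMl // scalerA mulrC.
rewrite -scaler_suml dual_orthogonality // eq_sym; case: eqP => [->|_].
  by rewrite scalerA mulVf ?scale1r ?cardG_neq0.
by rewrite scale0r scaler0.
Qed.

Lemma char_idemE chi x : dual A chi -> e A chi x = #|A|%:R^-1 * chi x^-1%g.
Proof.
move=> [_ _ chi0]; rewrite galgZE galg_sumE; congr (_ * _).
case: (boolP (x \in A)) => xA.
  rewrite (bigD1 x) //= big1 ?addr0 => [|y /andP[_ /negPf yx]].
    by rewrite galgZE ffunE eqxx mulr1.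
  by rewrite galgZE ffunE eq_sym yx mulr0.
rewrite chi0 ?groupV // big1 // => y yA; rewrite galgZE ffunE.
by case: eqP yA xA => [->|]; rewrite ?mulr0 // => ->.
Qed.

Lemma char_idem_neq0 chi : dual A chi -> e A chi != 0.
Proof.
move=> chiP; apply/eqP=> /(congr1 (fun u : KG => u 1%g : K)) /eqP.
rewrite char_idemE // invg1 dual_at1 // mulr1 ffunE.
by rewrite invr_eq0 (negPf (cardG_neq0 _)).
Qed.

Lemma gcounit_char_idem chi : dual A chi ->
  gcounit (e A chi) = (chi == trivial_char K A)%:R.
Proof.
move=> chiP; rewrite linearZ linear_sum /=.
have := dual_orthogonality dual_trivial chiP; rewrite eq_sym => E.
transitivity (#|A|%:R^-1 * \sum_(a in A) trivial_char K A a * chi a^-1%g).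
  congr (_ * _); apply: eq_bigr => a aA.
  by rewrite linearZ /= gcounit_base mulr1 ffunE aA mul1r.
by rewrite E; case: eqP; rewrite ?mulr0 // mulVf ?cardG_neq0.
Qed.

Lemma gantipode_char_idem chi : dual A chi -> gantipode (e A chi) =
  e A (dual_inv chi).
Proof.
move=> chiP; rewrite linearZ linear_sum /=; congr (_ *: _).
rewrite (reindex_inj invg_inj) /= (eq_bigl (fun a => a \in A)); last first.
  by move=> a; rewrite groupV.
by apply: eq_bigr => a _; rewrite linearZ /= gantipode_base !ffunE invgK.
Qed.

Lemma dual_act chi q : q \in 'N(A)%g -> dual A chi -> dual A (char_act q chi).
Proof.
move=> qN [chiM chi0 chi1]; split=> [x y xA yA|x xA|x xA]; rewrite !ffunE.
- by rewrite conjMg chiM ?memJ_norm.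
- by rewrite chi0 ?memJ_norm.
- by rewrite chi1 ?memJ_norm.
Qed.

Lemma char_idemJ chi q : q \in 'N(A)%g ->
  gbase K q * e A chi * gbase K q^-1 = e A (char_act q chi).
Proof.
move=> qN; rewrite -scalerAr -scalerAl; congr (_ *: _).
rewrite mulr_sumr mulr_suml (reindex_inj (conjg_inj q)) /=.
rewrite (eq_bigl (fun a => a \in A)); last by move=> a; rewrite memJ_norm.
apply: eq_bigr => a aA; rewrite -scalerAr -scalerAl !gbaseM ffunE conjVg;
  congr (_ *: _).
by rewrite conjgE !mulgA mulgV mul1g mulgK.
Qed.

Lemma char_idem_conj chi q : q \in 'N(A)%g ->
  gbase K q * e A chi = e A (char_act q chi) * gbase K q.
Proof. by move=> qN; rewrite -char_idemJ // -[RHS]mulrA gbaseVl mulr1. Qed.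

Lemma dual_invP chi : abelian A -> dual A chi -> dual A (dual_inv chi).
Proof.
move=> abA [chiM chi0 chi1]; split=> [x y xA yA|x xA|x xA]; rewrite !ffunE.
- by rewrite invMg chiM ?groupV // mulrC.
- by rewrite chi0 ?groupV.
- by rewrite chi1 ?groupV.
Qed.

(** A complete list of characters, certified by its length alone; completeness is derived in
    [split_dual_mem]. *)
Definition split_dual (s : seq {ffun gT -> K}) :=
  [/\ uniq s, forall chi, chi \in s -> dual A chi & size s = #|A|].

Variable s : seq {ffun gT -> K}.
Hypothesis sP : split_dual s.

(** The character table is square, so the right inverse given by row orthogonality is also a left
    inverse, which is column orthogonality. *)
Lemma split_dual_orthogonality a : a \in A ->
  \sum_(chi <- s) chi a = if a == 1%g then #|A|%:R else 0.
Proof.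
case: sP => us sD sz aA; pose n := #|A|.
pose chi (i : 'I_n) := nth [ffun=> 0] s i.
have chiP i : dual A (chi i) by apply: sD; rewrite mem_nth // sz.
pose X : 'M[K]_n := \matrix_(i, j) chi i (enum_val j).
pose Y : 'M[K]_n := \matrix_(j, i) (#|A|%:R^-1 * chi i (enum_val j)^-1%g).
have XY : X *m Y = 1%:M.
  apply/matrixP=> i j; rewrite !mxE.
  under eq_bigr do rewrite !mxE mulrCA.
  rewrite -mulr_sumr -(big_enum_val (fun a => chi i a * chi j a^-1%g)) /=.
  rewrite dual_orthogonality // /chi nth_uniq ?sz // -[_ == _ :> nat]/(i == j).
  by case: eqP; rewrite ?mulr0 // mulVf ?cardG_neq0.
have := mulmx1C XY => /matrixP/(_ (enum_rank_in aA 1%g) (enum_rank_in aA a)).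
rewrite !mxE => E.
have -> : \sum_(chi <- s) chi a =
  #|A|%:R * (enum_rank_in aA 1%g == enum_rank_in aA a)%:R.
  rewrite -E mulr_sumr (big_nth [ffun=> 0]) big_mkord sz.
  apply: eq_bigr => i _; rewrite !mxE !enum_rankK_in ?group1 // invg1.
  by rewrite -/(chi i) dual_at1 // mulr1 mulrA mulfV ?cardG_neq0 // mul1r.
have -> : (enum_rank_in aA 1%g == enum_rank_in aA a) = (a == 1%g).
  apply/eqP/eqP => [/(congr1 enum_val)|a1].
    by rewrite !enum_rankK_in ?group1.
  by apply: enum_val_inj; rewrite !enum_rankK_in ?group1.
by case: eqP; rewrite ?mulr1 ?mulr0.
Qed.

Lemma split_dual_sum1 : \sum_(chi <- s) e A chi = 1.
Proof.
case: (sP) => us sD sz; rewrite -scaler_sumr exchange_big /=.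
rewrite (eq_bigr (fun a => (if a == 1%g then #|A|%:R else 0) *: gbase K a));
  last first.
  move=> a aA; rewrite -scaler_suml split_dual_orthogonality ?groupV //.
  by rewrite -eq_invg1 invgK.
rewrite (bigD1 1%g) //= big1 ?addr0 => [|a /andP[_ /negPf ->]];
  last by rewrite scale0r.
by rewrite eqxx scalerA mulVf ?cardG_neq0 // scale1r.
Qed.

(** The idempotent of a missing character would be orthogonal to all terms of a decomposition of 1,
    hence zero. *)
Lemma split_dual_mem chi : dual A chi -> chi \in s.
Proof.
move=> chiP; apply: contraT => chis; have := char_idem_neq0 chiP.
rewrite -[e A chi]mulr1 -split_dual_sum1 mulr_sumr big_seq big1 ?eqxx // =>
  psi psis.
rewrite char_idemM //; last by case: sP => _ + _; apply.
by case: eqP chis => // ->; rewrite psis.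
Qed.

Lemma split_dual_gbase a : a \in A -> gbase K a =
  \sum_(chi <- s) chi a *: e A chi.
Proof.
move=> aA; rewrite -[LHS]mulr1 -split_dual_sum1 mulr_sumr big_seq [RHS]big_seq.
by apply: eq_bigr => chi chis; rewrite char_idemMl //; case: sP => _ + _; apply.
Qed.

(** Expand the first leg of each a (x) a along the idempotents; the sum over a then recombines in
    the second leg. *)
Lemma gcomul_char_idem chi :
  gcomul (e A chi) =
  \sum_(psi <- s) gtens (e A psi) (e A (dual_mul chi (dual_inv psi))).
Proof.
rewrite linearZ linear_sum /=.
under eq_bigr => a aA do rewrite linearZ /= gcomul_base {1}split_dual_gbase //
  gtens_suml scaler_sumr.
rewrite exchange_big scaler_sumr; apply: eq_bigr => psi _.
rewrite gtensZr gtens_sumr; congr (_ *: _); apply: eq_bigr => a aA.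
by rewrite gtensZl gtensZr scalerA; congr (_ *: _); rewrite !ffunE invgK.
Qed.

End OneGroup.
End CharacterTheory.

(** * The twist *)

(** Here [L :^ tau^-1] stands for tau L tau^-1, since [x ^ q] is q^-1 x q. *)
Record twist_setting (K : fieldExtType rat) (gT : finGroupType)
    (N Q L P : {group gT}) (tau : gT) (f : gT -> {ffun gT -> K}) : Prop :=
  TwistSetting {
    ts_sdprod : (N ><| Q)%g = [set: gT]%SET;
    ts_abN : abelian N;
    ts_sLN : L \subset N;
    ts_sPQ : P \subset Q;
    ts_abP : abelian P;
    ts_tau : tau \in Q;
    ts_isog : L \isog P;
    ts_cLP : P \subset 'C(L)%g;
    ts_faithful : [faithful Q, on N | 'J];
    ts_dprod : (L \x (L :^ tau^-1))%g = N;
    ts_fixN : ('Fix_(N | 'J)[tau])%g <> 1%g;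
    ts_fix_dual : forall sigma, sigma \in P -> sigma != 1%g ->
       dual_fix N (sigma * tau)%g = [set trivial_char K N] /\
       dual_fix N tau `&` dual_fix N (sigma * tau * sigma^-1)%g
         = [set trivial_char K N];
    ts_iso : dual_iso P L f }.

Section Twist.
Variables (K : fieldExtType rat) (gT : finGroupType) (N Q L P : {group gT})
  (tau : gT) (f : gT -> {ffun gT -> K}).
Hypothesis S : twist_setting N Q L P tau f.
Local Notation KG := (galg K gT).
Local Notation KG2 := (galg K (gT * gT)%type).
Local Notation "[ g ]" := (gbase K g) (at level 0, g at level 99, format "[ g ]").

Lemma P_sub_Q p : p \in P -> p \in Q.
Proof. exact: (fintype.subsetP (ts_sPQ S)). Qed.

Lemma mulPC : {in P &, forall x y, (x * y)%g = (y * x)%g}.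
Proof. by move=> x y xP yP; apply: (centsP (ts_abP S)). Qed.

Lemma mulPLC x l : x \in P -> l \in L -> (x * l)%g = (l * x)%g.
Proof. by move=> xP lL; apply: (centsP (ts_cLP S)). Qed.

Lemma iso_dual x : x \in P -> dual L (f x).
Proof. by move=> xP; case: (ts_iso S) => _ [fP _ _]; apply: fP. Qed.

Lemma iso_inj : {in P &, injective f}.
Proof.
by move=> x y xP yP; case: (ts_iso S) => _ [_ fI _]; apply: fI; rewrite inE.
Qed.

Lemma iso_surj chi : dual L chi -> exists2 x, x \in P & chi = f x.
Proof. by case: (ts_iso S) => _ [_ _ fS] /fS[x /= xP <-]; exists x. Qed.

Lemma iso_out x a : x \in P -> a \notin L -> f x a = 0.
Proof. by move=> /iso_dual[_ _]; apply. Qed.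

Lemma isoM x y : x \in P -> y \in P -> f (x * y)%g = dual_mul (f x) (f y).
Proof.
by move=> xP yP; apply/ffunP=> a; rewrite ffunE; case: (ts_iso S) => + _; apply.
Qed.

Lemma iso1 : f 1%g = trivial_char K L.
Proof.
have [x xP fx] := iso_surj (dual_trivial K L); rewrite fx; congr f; apply/esym.
apply: (mulgI x); rewrite mulg1; apply: iso_inj; rewrite ?groupM //.
rewrite isoM // -fx; apply/ffunP=> a; rewrite !ffunE.
by case: (a \in L); rewrite ?mulr1 ?mulr0.
Qed.

Lemma isoV x : x \in P -> f x^-1%g = dual_inv (f x).
Proof.
move=> xP; have fVx : forall a, a \in L -> f x^-1%g a = (f x a)^-1.
  move=> a aL; have fx0 : f x a != 0 by case: (iso_dual xP) => _ ->.
  apply: (mulfI fx0); rewrite mulfV //.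
  have := isoM xP (groupVr xP); rewrite mulgV iso1 => /ffunP/(_ a).
  by rewrite !ffunE aL.
apply/ffunP=> a; rewrite ffunE; case: (boolP (a \in L)) => aL.
  by rewrite fVx // (dualV (iso_dual xP)).
have [_ _ ->] := iso_dual (groupVr xP) => //.
by have [_ _ ->] := iso_dual xP; rewrite ?groupV.
Qed.

Lemma card_P : #|P| = #|L|. Proof. by rewrite (card_isog (ts_isog S)). Qed.

(** The isomorphism [f] exhibits [#|P|] distinct characters of [L], and [#|P| = #|L|]. *)
Lemma split_dual_L : split_dual L [seq f x | x <- enum P].
Proof.
split; last by rewrite size_map -cardE card_P.
  by rewrite map_inj_in_uniq ?enum_uniq // => x y; rewrite !mem_enum;
    apply: iso_inj.
by move=> chi /mapP[x]; rewrite mem_enum => xP ->; apply: iso_dual.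
Qed.

(** Indexing by [P] through [f] turns products of characters of [L] into products in [P]. *)
Definition idemL x : KG := char_idem L (f x).
Local Notation E := idemL.

Lemma idemLM x y : x \in P -> y \in P -> E x * E y = if x == y then E x else 0.
Proof. by move=> xP yP; rewrite char_idemM ?(inj_in_eq iso_inj) //;
  apply: iso_dual. Qed.

Lemma idemL_sum1 : \sum_(x in P) E x = 1.
Proof. by have := split_dual_sum1 split_dual_L; rewrite big_map big_enum. Qed.

Lemma idemL_base x l : x \in P -> l \in L -> [l] * E x = f x l *: E x.
Proof. by move=> xP lL; rewrite char_idemMl //; apply: iso_dual. Qed.

Lemma gcomul_idemL x : x \in P ->
  gcomul (E x) = \sum_(y in P) gtens (E y) (E (x * y^-1)).
Proof.
move=> xP; rewrite (gcomul_char_idem split_dual_L) big_map big_enum /=.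
by apply: eq_bigr => y yP; rewrite /idemL isoM ?groupV // isoV.
Qed.

Lemma gcounit_idemL x : x \in P -> gcounit (E x) = (x == 1%g)%:R.
Proof.
move=> xP; rewrite (gcounit_char_idem (iso_dual xP)) -iso1.
by rewrite (inj_in_eq iso_inj).
Qed.

Lemma idemL_baseC x p : x \in P -> p \in P -> [p] * E x = E x * [p].
Proof.
move=> xP pP; rewrite -scalerAl -scalerAr; congr (_ *: _).
rewrite mulr_sumr mulr_suml; apply: eq_bigr => l lL.
by rewrite -scalerAl -scalerAr !gbaseM mulPLC.
Qed.

Lemma sum_diag (V : nmodType) (F : gT -> gT -> V) x : x \in P ->
  \sum_(y in P) (if x == y then F x y else 0) = F x x.
Proof.
move=> xP; rewrite (bigD1 x) //= eqxx big1 ?addr0 // => y /andP[_ /negPf].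
by rewrite eq_sym => ->.
Qed.

Definition twistJ : KG2 := \sum_(x in P) gtens (E x) [x].
Definition twistV : KG2 := \sum_(x in P) gtens (E x) [x^-1].

Lemma sum_gtens_diag (g h : gT -> KG) :
  (\sum_(x in P) gtens (E x) (g x)) * (\sum_(y in P) gtens (E y) (h y)) =
  \sum_(x in P) gtens (E x) (g x * h x).
Proof.
rewrite big_distrlr /=; apply: eq_bigr => x xP.
under eq_bigr => y yP do rewrite gtensM idemLM //.
rewrite -(sum_diag (fun x y => gtens (E x) (g x * h y)) xP).
apply: eq_bigr => y yP; case: eqP => // _.
by apply/ffunP=> p; rewrite !ffunE mul0r.
Qed.

Lemma sum_gtens1 : \sum_(x in P) gtens (E x) 1 = 1 :> KG2.
Proof. by rewrite -gtens_suml idemL_sum1 gtens11. Qed.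

Lemma twistJV : twistJ * twistV = 1.
Proof.
by rewrite sum_gtens_diag -sum_gtens1; apply: eq_bigr => x _; rewrite gbaseVr.
Qed.

Lemma twistVJ : twistV * twistJ = 1.
Proof.
by rewrite sum_gtens_diag -sum_gtens1; apply: eq_bigr => x _; rewrite gbaseVl.
Qed.

Lemma mulr_inv (A : unitRingType) (x y : A) : x * y = 1 -> y * x = 1 -> x^-1 =
  y.
Proof.
move=> xy yx; have Ux : x \is a GRing.unit by apply/unitrP; exists y.
by apply: (mulrI Ux); rewrite divrr.
Qed.

Lemma twistJ_inv : twistJ^-1 = twistV.
Proof. by apply: mulr_inv; [apply: twistJV | apply: twistVJ]. Qed.

(** For fixed x the sum of the rho(x) e_rho over the characters rho of [P] is x itself. *)
Lemma twistE : twist L P f = twistJ.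
Proof.
have dualL : dual L = [set` [seq f x | x <- enum P]].
  apply/seteqP; split=> chi /=; last by case: split_dual_L => _ + _; apply.
  exact: (split_dual_mem split_dual_L).
(* Transporting the characters of [L] along [h : P -> L] provides [#|P|] characters of [P]. *)
have [h injh hL] := isogP (isog_symr (ts_isog S)).
have hPL p : p \in P -> h p \in L by move=> pP; rewrite -hL mem_morphim.
pose r chi : {ffun gT -> K} := [ffun p => if p \in P then chi (h p) else 0].
have r_dual chi : dual L chi -> dual P (r chi).
  move=> [chiM chi0 chi1]; split=> [x y xP yP|x xP|x /negPf xP]; rewrite !ffunE.
  - by rewrite groupM // xP yP morphM // chiM ?hPL.
  - by rewrite xP chi0 ?hPL.
  - by rewrite xP.
pose sP := [seq r (f x) | x <- enum P].
have splitP : split_dual P sP.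
  split; last by rewrite size_map -cardE.
    rewrite map_inj_in_uniq ?enum_uniq // => x y;
      rewrite !mem_enum => xP yP rxy.
    apply: iso_inj => //; apply/ffunP=> l; case: (boolP (l \in L)) => lL;
      last first.
      by have [_ _ ->] := iso_dual xP => //; have [_ _ ->] := iso_dual yP.
    move: lL; rewrite -hL => /morphimP[p _ pP ->].
    by move/ffunP/(_ p): rxy; rewrite !ffunE pP.
  by move=> chi /mapP[x]; rewrite mem_enum => xP ->; apply/r_dual/iso_dual.
have dualP : dual P = [set` sP].
  apply/seteqP; split=> chi /=; last by case: splitP => _ + _; apply.
  exact: (split_dual_mem splitP).
rewrite /twist dualL dualP -fsbig_seq; last by case: split_dual_L.
rewrite big_map big_enum /=; apply: eq_bigr => x xP.
rewrite -fsbig_seq; last by case: splitP.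
have -> : dual_iso_inv P f (f x) = x.
  rewrite /dual_iso_inv; case: pickP => [y /andP[yP /eqP/iso_inj-> //]|/(_ x)].
  by rewrite /= xP eqxx.
rewrite (split_dual_gbase splitP xP) gtens_sumr.
by apply: eq_bigr => rho _; rewrite [RHS]gtensZr.
Qed.

Definition comulJ u : KG2 := twistJ * gcomul u * twistV.

Lemma comulJ_linear : linear comulJ.
Proof.
move=> k u v; rewrite /comulJ linearP mulrDr mulrDl.
by rewrite -scalerAr -scalerAl.
Qed.
HB.instance Definition _ := GRing.isLinear.Build _ _ _ _ comulJ comulJ_linear.

Lemma gcomulE u : gcomul u = twistV * comulJ u * twistJ.
Proof. by rewrite /comulJ !mulrA twistVJ mul1r -mulrA twistVJ mulr1. Qed.

Lemma twistJ_base p : p \in P -> twistJ * gtens [p] [p] =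
  gtens [p] [p] * twistJ.
Proof.
move=> pP; rewrite mulr_suml mulr_sumr; apply: eq_bigr => x xP.
by rewrite !gtensM idemL_baseC // !gbaseM mulPC.
Qed.

Lemma comulJ_base p : p \in P -> comulJ [p] = gtens [p] [p].
Proof.
by move=> pP; rewrite /comulJ gcomul_base twistJ_base // -mulrA twistJV mulr1.
Qed.

Lemma twistV_base p : p \in P -> gtens [p] [p] * twistV =
  twistV * gtens [p] [p].
Proof.
move=> pP; rewrite mulr_suml mulr_sumr; apply: eq_bigr => x xP.
by rewrite !gtensM idemL_baseC // !gbaseM mulPC ?groupV.
Qed.

Lemma twistJ_idemL x : x \in P ->
  twistJ * gcomul (E x) = \sum_(y in P) gtens (E y) ([y] * E (x * y^-1)).
Proof. by move=> xP; rewrite gcomul_idemL // sum_gtens_diag. Qed.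

Lemma idemL_twistV x : x \in P ->
  gcomul (E x) * twistV = \sum_(y in P) gtens (E y) (E (x * y^-1) * [y^-1]).
Proof. by move=> xP; rewrite gcomul_idemL // sum_gtens_diag. Qed.

(** The twist and the coproduct of [E x] lie in the tensor square of the commutative algebra KM, so
    conjugation has no effect. *)
Lemma comulJ_idemL x : x \in P -> comulJ (E x) = gcomul (E x).
Proof.
move=> xP; rewrite /comulJ twistJ_idemL // sum_gtens_diag gcomul_idemL //.
apply: eq_bigr => y yP; rewrite idemL_baseC ?groupM ?groupV //.
by rewrite -mulrA gbaseVr mulr1.
Qed.

End Twist.

(** * The action of the group on characters *)

Lemma char_actM (K : fieldExtType rat) (gT : finGroupType) (q r : gT)
  (chi : {ffun gT -> K}) :
  char_act (q * r) chi = char_act q (char_act r chi).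
Proof. by apply/ffunP=> x; rewrite !ffunE conjgM. Qed.

Lemma char_act1 (K : fieldExtType rat) (gT : finGroupType)
  (chi : {ffun gT -> K}) :
  char_act 1 chi = chi.
Proof. by apply/ffunP=> x; rewrite ffunE conjg1. Qed.

Lemma char_actK (K : fieldExtType rat) (gT : finGroupType) (q : gT) :
  cancel (@char_act K gT q) (char_act q^-1).
Proof. by move=> chi; rewrite -char_actM mulVg char_act1. Qed.

Lemma char_actVK (K : fieldExtType rat) (gT : finGroupType) (q : gT) :
  cancel (@char_act K gT q^-1) (char_act q).
Proof. by move=> chi; rewrite -char_actM mulgV char_act1. Qed.

Lemma char_act_fixV (K : fieldExtType rat) (gT : finGroupType) (q : gT)
  (chi : {ffun gT -> K}) :
  (char_act q^-1 chi == chi) = (char_act q chi == chi).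
Proof.
apply/eqP/eqP => E; first by rewrite -{1}E char_actVK.
by rewrite -{1}E char_actK.
Qed.

Lemma char_act_mul (K : fieldExtType rat) (gT : finGroupType) (q : gT)
  (chi psi : {ffun gT -> K}) :
  char_act q (dual_mul chi psi) = dual_mul (char_act q chi) (char_act q psi).
Proof. by apply/ffunP=> x; rewrite !ffunE. Qed.

Lemma char_act_trivial (K : fieldExtType rat) (gT : finGroupType)
  (A : {group gT}) (q : gT) :
  q \in 'N(A)%g -> char_act q (trivial_char K A) = trivial_char K A.
Proof. by move=> qN; apply/ffunP=> x; rewrite !ffunE memJ_norm. Qed.

Lemma char_idem_absorb (K : fieldExtType rat) (gT : finGroupType)
  (A : {group gT})
    (chi : {ffun gT -> K}) (h : galg K gT) : dual A chi ->
  (forall a, a \in A -> gbase K a * h = chi a *: h) -> char_idem A chi * h = h.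
Proof.
move=> chiP hA; rewrite -scalerAl mulr_suml.
under eq_bigr => a aA do rewrite -scalerAl hA // scalerA mulrC.
rewrite -scaler_suml dual_orthogonality // eqxx scalerA mulVf ?scale1r //.
exact: cardG_neq0.
Qed.

Lemma big_setX (V : nmodType) (I J : finType) (A : {set I}) (B : {set J})
  (F : I * J -> V) :
  \sum_(p in finset.setX A B) F p = \sum_(i in A) \sum_(j in B) F (i, j).
Proof.
by rewrite pair_big; apply: eq_big => [[i j]|[i j] _] //=;
  rewrite finset.in_setX.
Qed.

(** * Idempotents of KN and the coalgebra of the double coset of tau *)

Section Comatrix.
Variables (K : fieldExtType rat) (gT : finGroupType) (N Q L P : {group gT})
  (tau : gT) (f : gT -> {ffun gT -> K}).
Hypothesis S : twist_setting N Q L P tau f.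
Local Notation KG := (galg K gT).
Local Notation KG2 := (galg K (gT * gT)%type).
Local Notation "[ g ]" := (gbase K g) (at level 0, g at level 99, format "[ g ]").
Local Notation E := (idemL L f).

Definition idemL_tau y : KG := [tau] * E y * [tau^-1].
Local Notation E' := idemL_tau.
(** Since [N] is the direct sum of L and tau L, its primitive idempotents are products of one of
    each factor; see [char_idem_charN]. *)
Definition idemN x y : KG := E x * E' y.

Lemma L_sub_N l : l \in L -> l \in N.
Proof. exact: (fintype.subsetP (ts_sLN S)). Qed.

Lemma Q_norm_N q : q \in Q -> q \in 'N(N)%g.
Proof. exact: (sdprod_norm (ts_sdprod S)). Qed.

Lemma memNJ q x : q \in Q -> ((x ^ q)%g \in N) = (x \in N).
Proof. exact: (sdprod_memJ (ts_sdprod S)). Qed.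

Lemma conjL_sub_N l : l \in L -> (l ^ tau^-1)%g \in N.
Proof. by move=> lL; rewrite memNJ ?groupV ?(ts_tau S) // L_sub_N. Qed.

Lemma N_split n : n \in N ->
  exists l l', [/\ l \in L, l' \in L & n = (l * l' ^ tau^-1)%g].
Proof.
rewrite -(dprodW (ts_dprod S)) => /mulsgP[l m lL].
by rewrite mem_conjg invgK => mL ->; exists l, (m ^ tau)%g; rewrite conjgK.
Qed.

Lemma mulNC : {in N &, forall x y, (x * y)%g = (y * x)%g}.
Proof. by move=> x y xN yN; apply: (centsP (ts_abN S)). Qed.

Lemma idemL_baseN n x : n \in N -> [n] * E x = E x * [n].
Proof.
move=> nN; rewrite -scalerAl -scalerAr; congr (_ *: _).
rewrite mulr_sumr mulr_suml; apply: eq_bigr => l lL.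
by rewrite -scalerAl -scalerAr !gbaseM (mulNC nN (L_sub_N lL)).
Qed.

Lemma idemN_sum1 : \sum_(x in P) \sum_(y in P) idemN x y = 1.
Proof.
rewrite -big_distrlr /= (idemL_sum1 S) mul1r.
by rewrite -mulr_suml -mulr_sumr (idemL_sum1 S) mulr1 gbaseVr.
Qed.

(* As [N = L (x) tau L tau^-1], a character of [N] is a pair of characters of
   [L], hence a pair of elements of [P]. *)
Definition charN x y : {ffun gT -> K} :=
  [ffun n => if n \in N then
     f x (divgr L (L :^ tau^-1) n) * f y
       (remgr L (L :^ tau^-1) n ^ tau)%g else 0].
Local Notation nu := charN.

Lemma charNE x y l l' : l \in L -> l' \in L -> nu x y (l * l' ^ tau^-1)%g =
  f x l * f y l'.
Proof.
move=> lL l'L; rewrite ffunE (groupM (L_sub_N lL) (conjL_sub_N l'L)).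
have [_ _ _ ti] := dprodP (ts_dprod S).
have l'J : (l' ^ tau^-1)%g \in (L :^ tau^-1)%G by rewrite memJ_conjg.
by rewrite (divgrMid ti) // (remgrMid ti) // conjgKV.
Qed.

Lemma charN_L x y l : y \in P -> l \in L -> nu x y l = f x l.
Proof.
move=> yP lL; have := charNE x y lL (group1 L).
by rewrite conj1g mulg1 (dual_at1 (iso_dual S yP)) mulr1.
Qed.

Lemma charN_L' x y l : x \in P -> l \in L -> nu x y (l ^ tau^-1)%g = f y l.
Proof.
move=> xP lL; have := charNE x y (group1 L) lL.
by rewrite mul1g (dual_at1 (iso_dual S xP)) mul1r.
Qed.

Lemma charN_dual x y : x \in P -> y \in P -> dual N (nu x y).
Proof.
move=> xP yP; have [fxM fx0 _] := iso_dual S xP;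
  have [fyM fy0 _] := iso_dual S yP.
split=> [m n mN nN|n nN|n /negPf nN]; last by rewrite ffunE nN.
  have [l [l' [lL l'L ->]]] := N_split mN;
    have [k [k' [kL k'L ->]]] := N_split nN.
  have swap p q : p \in N -> (l * p * (k * q) = l * k * (p * q))%g.
    by move=> pN; rewrite !mulgA -(mulgA l p) (mulNC pN (L_sub_N kL)) !mulgA.
  rewrite swap ?conjL_sub_N // -conjMg.
  rewrite (charNE x y lL l'L) (charNE x y kL k'L).
  rewrite (charNE x y (groupM lL kL) (groupM l'L k'L)).
  by rewrite fxM // fyM // mulrACA.
by have [l [l' [lL l'L ->]]] := N_split nN;
  rewrite charNE // mulf_neq0 ?fx0 ?fy0.
Qed.

Lemma dualN_eq (chi psi : {ffun gT -> K}) : dual N chi -> dual N psi ->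
  {in L, chi =1 psi} -> (forall l, l \in L -> chi (l ^ tau^-1)%g =
    psi (l ^ tau^-1)%g) -> chi = psi.
Proof.
move=> [chiM _ chi0] [psiM _ psi0] eL eL'; apply/ffunP=> n.
case: (boolP (n \in N)) => nN; last by rewrite chi0 // psi0.
have [l [l' [lL l'L ->]]] := N_split nN.
have [lN l'N] := (L_sub_N lL, conjL_sub_N l'L).
by rewrite chiM // psiM // eL // eL'.
Qed.

Lemma charN_inj x y x' y' : x \in P -> y \in P -> x' \in P -> y' \in P ->
  nu x y = nu x' y' -> x = x' /\ y = y'.
Proof.
move=> xP yP x'P y'P eq_nu;
  have out z z' a : z \in P -> z' \in P -> a \notin L -> f z a = f z' a.
  by move=> zP z'P aL; rewrite (iso_out S zP aL) (iso_out S z'P aL).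
split; apply: (iso_inj S) => //; apply/ffunP=> a; case: (boolP (a \in L)) => lL;
  try exact: out.
  by rewrite -(charN_L x yP lL) eq_nu charN_L.
by rewrite -(charN_L' y xP lL) eq_nu charN_L'.
Qed.

Lemma charN_mul x y x' y' : x \in P -> y \in P -> x' \in P -> y' \in P ->
  dual_mul (nu x y) (nu x' y') = nu (x * x') (y * y').
Proof.
move=> xP yP x'P y'P; apply: dualN_eq => [||l lL|l lL].
- by apply: dual_mulP; apply: charN_dual.
- by apply: charN_dual; rewrite groupM.
- by rewrite ffunE !charN_L ?groupM // (isoM S) // ffunE.
- by rewrite ffunE !charN_L' ?groupM // (isoM S) // ffunE.
Qed.

Lemma charN1 : nu 1 1 = trivial_char K N.
Proof.
apply: dualN_eq => [||l lL|l lL]; first by apply: charN_dual; rewrite group1.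
- exact: dual_trivial.
- by rewrite charN_L ?group1 // (iso1 S) !ffunE lL L_sub_N.
- by rewrite charN_L' ?group1 // (iso1 S) !ffunE lL conjL_sub_N.
Qed.

Lemma idemN_base x y n : x \in P -> y \in P -> n \in N -> [n] * idemN x y =
  nu x y n *: idemN x y.
Proof.
move=> xP yP nN; have [l [l' [lL l'L ->]]] := N_split nN.
have mE' : [l' ^ tau^-1] * E' y = f y l' *: E' y.
  rewrite /idemL_tau !mulrA gbaseM.
  have -> : (l' ^ tau^-1 * tau =
    tau * l')%g by rewrite conjgE invgK mulgA mulgKV.
  rewrite -gbaseM -(mulrA [tau]) (idemL_base S) //.
  by rewrite -(scalerAr (f y l') [tau]) -(scalerAl (f y l')).
rewrite charNE // -gbaseM /idemN -mulrA (mulrA [l' ^ tau^-1]).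
rewrite (idemL_baseN _ (conjL_sub_N l'L)) -mulrA mE' mulrA (idemL_base S) //.
by rewrite -(scalerAl (f x l)) -(scalerAr (f y l')) scalerA.
Qed.

(** Multiply by the decomposition of 1 into the [idemN x' y']. Each of these is absorbed by the
    idempotent of [nu x' y'], so orthogonality leaves only the pair [(x, y)]. *)
Lemma char_idem_charN x y : x \in P -> y \in P -> char_idem N (nu x y) =
  idemN x y.
Proof.
move=> xP yP; rewrite -[LHS]mulr1 -idemN_sum1 pair_big mulr_sumr /=.
rewrite (bigD1 (x, y)) ?xP //= big1 ?addr0 =>
  [|[x' y'] /= /andP[/andP[x'P y'P] neq]].
  by apply: char_idem_absorb => [|n nN];
    [apply: charN_dual | apply: idemN_base].
rewrite -[idemN x' y'](@char_idem_absorb _ _ N (nu x' y')); last 2 first.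
- exact: charN_dual.
- by move=> n nN; apply: idemN_base.
rewrite mulrA char_idemM; [|exact: charN_dual..].
case: eqP => [/charN_inj[] // E1 E2|_]; last by rewrite mul0r.
by rewrite E1 E2 eqxx in neq.
Qed.

Lemma card_N : #|N| = (#|P| * #|P|)%N.
Proof. by rewrite -(dprod_card (ts_dprod S)) cardJg (card_P S). Qed.

Definition charsN := [seq nu x y | x <- enum P, y <- enum P].

Lemma split_dual_N : split_dual N charsN.
Proof.
split; last by rewrite size_allpairs -cardE card_N.
  apply: allpairs_uniq; rewrite ?enum_uniq // => -[x y] [x' y'].
  move=> /allpairsP[[a b] /= []]; rewrite !mem_enum => aP bP [-> ->].
  move=> /allpairsP[[c d] /= []]; rewrite !mem_enum => cP dP [-> ->].
  by move=> /charN_inj[] // -> ->.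
by move=> chi /allpairsP[[x y] /= []]; rewrite !mem_enum => xP yP ->;
  apply: charN_dual.
Qed.

Lemma dualN_charN chi : dual N chi ->
  exists x y, [/\ x \in P, y \in P & chi = nu x y].
Proof.
move=> /(split_dual_mem split_dual_N) /allpairsP[[x y] /= []].
by rewrite !mem_enum => xP yP ->; exists x, y.
Qed.

Lemma sum_charsN (V : nmodType) (F : {ffun gT -> K} -> V) :
  \sum_(chi <- charsN) F chi = \sum_(x in P) \sum_(y in P) F (nu x y).
Proof.
by rewrite big_allpairs_dep /= big_enum; apply: eq_bigr => x _;
  rewrite big_enum.
Qed.

(** The character restricts to [f x] on L and to the transport of [f y] on tau L, and tau carries L
    onto tau L. *)
Lemma charN_fix_tau x y : x \in P -> y \in P -> char_act tau (nu x y) =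
  nu x y -> x = y.
Proof.
move=> xP yP fix_nu; apply: (iso_inj S) => //; apply/ffunP=> l.
case: (boolP (l \in L)) => lL; last by rewrite !(iso_out S).
by rewrite -(charN_L x yP lL) -(charN_L' y xP lL) -[in RHS]fix_nu [RHS]ffunE
  conjgKV.
Qed.

(* [J * Delta(a * E x)] and [Delta(E y * c) * J^-1] are both given by matrix
   comultiplication, the matrix units being indexed by [P]; hence the twisted
   coproduct makes [K[M tau M]] a matrix coalgebra with units indexed by
   [P * P]. *)
Definition comatrix (i k : gT * gT) : KG :=
  [i.1] * E (i.1^-1 * k.1) * [tau] * (E (i.2 * k.2^-1) * [i.2]).
Local Notation T := comatrix.

Lemma comatrixE i k :
  T i k = [i.1] * idemN (i.1^-1 * k.1) (i.2 * k.2^-1) * [tau * i.2].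
Proof.
rewrite /comatrix /idemN /idemL_tau -gbaseM !mulrA.
by rewrite -[_ * [tau^-1] * [tau]]mulrA gbaseVl mulr1.
Qed.

Lemma gcounit_comatrix : {in finset.setX P P &, forall i k, gcounit (T i k) =
  (i == k)%:R}.
Proof.
move=> [a c] [b d] /finset.setXP[aP cP] /finset.setXP[bP dP] /=.
rewrite !gcounitM !gcounit_base mul1r !mulr1 !(gcounit_idemL S) ?groupM
  ?groupV //=.
rewrite -natrM mulnb xpair_eqE; congr (_ && _)%:R.
  by rewrite -eq_mulVg1.
by rewrite -eq_mulgV1.
Qed.

Lemma comulJ_comatrix : {in finset.setX P P &, forall i k,
  comulJ L P f (T i k) = \sum_(j in finset.setX P P) gtens (T i j) (T j k)}.
Proof.
move=> [a c] [b d] /finset.setXP[aP cP] /finset.setXP[bP dP] /=.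
have xP : (a^-1 * b)%g \in P by rewrite groupM ?groupV.
have yP : (c * d^-1)%g \in P by rewrite groupM ?groupV.
rewrite /comulJ !gcomulM !gcomul_base !mulrA (twistJ_base S) //=.
rewrite -[_ * twistJ _ _ _ * gcomul _]mulrA (twistJ_idemL S) //.
rewrite big_setX /=.
rewrite -[_ * gtens [c] [c] * twistV _ _ _]mulrA (twistV_base S) // mulrA.
rewrite -[_ * gcomul (E (c * d^-1)) * _]mulrA (idemL_twistV S) //.
(* The middle index becomes [(a * k, l^-1 * c)], where [k] comes from the factor with J and [l] from
   the factor with its inverse. *)
rewrite [RHS](reindex_inj (mulgI a)) [RHS](eq_bigl (mem P)) => [|k];
  last by rewrite /= groupMl.
rewrite (mulr_sumr _ _ _ (gtens [a] [a])) !mulr_suml; apply: eq_bigr => k kP.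
rewrite [RHS](reindex_inj (inj_comp (mulIg c) invg_inj))
  [RHS](eq_bigl (mem P)) => [|l]; last first.
  by rewrite /= groupMr ?groupV.
rewrite mulr_sumr mulr_suml; apply: eq_bigr => l lP.
rewrite !gtensM; congr gtens; rewrite /comatrix /=.
  by rewrite mulKg invMg invgK mulKVg !mulrA.
have -> : ((a * k)^-1 * b)%g = (a^-1 * b * k^-1)%g.
  by rewrite invMg -mulgA (mulPC S) ?groupM ?groupV.
have -> : (l^-1 * c * d^-1)%g = (c * d^-1 * l^-1)%g.
  by rewrite -mulgA (mulPC S) ?groupM ?groupV.
by rewrite -!gbaseM !mulrA.
Qed.

End Comatrix.

Lemma natf_inj (K : fieldExtType rat) m n : m%:R = n%:R :> K -> m = n.
Proof.
rewrite -(rmorph_nat (in_alg K)) -(rmorph_nat (in_alg K) n) => /fmorph_inj/eqP.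
by rewrite eqr_nat => /eqP.
Qed.

(** * The characters of N fixed by tau *)

Section OrderContainsGroup.
Variables (K : fieldExtType rat) (gT : finGroupType) (N Q L P : {group gT})
  (tau : gT) (f : gT -> {ffun gT -> K}).
Hypothesis S : twist_setting N Q L P tau f.
Local Notation KG := (galg K gT).
Local Notation KG2 := (galg K (gT * gT)%type).
Local Notation O := (@algebraic_integer K).
Local Notation "[ g ]" := (gbase K g) (at level 0, g at level 99, format "[ g ]").
Local Notation E := (idemL L f).
Local Notation eN := (idemN L tau f).
Local Notation nu := (charN N L tau f).
Local Notation T := (comatrix L tau f).
Local Notation chi := (@coset_trace gT N Q K).

(** Summing over the fixed cosets turns the trace into the scalar product of [char_act q^-1 psi]
    with [psi]. *)
Lemma coset_trace_char_idem psi q : dual N psi -> q \in Q ->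
  chi (char_idem N psi * [q]) = (char_act q psi == psi)%:R.
Proof.
move=> psiP qQ; have qVN : q^-1%g \in 'N(N)%g by rewrite groupV (Q_norm_N S).
rewrite -scalerAl mulr_suml.
under eq_bigr => n nN do rewrite -scalerAl gbaseM.
rewrite (scalarZ (@coset_trace_scalar gT N Q K))
  (scalar_sumZ (@coset_trace_scalar gT N Q K)).
under eq_bigr => n nN do rewrite (coset_trace_base (ts_sdprod S) _ nN qQ)
  mulr_sumr.
rewrite exchange_big /=.
transitivity (#|N|%:R^-1 * \sum_(m in N) char_act q^-1 psi m * psi m^-1%g).
  congr (_ * _); apply: eq_bigr => m mN.
  have m'N : (m ^ q^-1)%g \in N by rewrite memJ_norm.
  have nN : (m * m^-1 ^ q^-1)%g \in N by rewrite groupM // conjVg groupV.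
  rewrite (bigD1 (m * m^-1 ^ q^-1)%g) //= eqxx mulr1 big1 ?addr0; last first.
    by move=> n /andP[_ /negPf ->]; rewrite mulr0.
  case: psiP => psiM _ _; rewrite ffunE invMg conjVg invgK psiM ?groupV //.
rewrite (dual_orthogonality (dual_act qVN psiP) psiP) char_act_fixV.
by case: eqP; rewrite ?mulr0 // mulVf ?cardG_neq0.
Qed.

Lemma coset_trace_idemN x y q : x \in P -> y \in P -> q \in Q ->
  chi (eN x y * [q]) = (char_act q (nu x y) == nu x y)%:R.
Proof.
move=> xP yP qQ; rewrite -(char_idem_charN S xP yP).
by rewrite coset_trace_char_idem //; apply: (charN_dual S).
Qed.

(** By [charN_fix_tau] every [tau]-fixed character of [N] has the form [nu x x], so this is the
    group of these characters seen inside [P]. *)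
Definition fixP : {set gT} := [set x in P | char_act tau (nu x x) == nu x x].

Lemma fixP_group_set : group_set fixP.
Proof.
have tN := Q_norm_N S (ts_tau S).
apply/group_setP; split=> [|x y].
  by rewrite inE group1 (charN1 S) char_act_trivial // eqxx.
rewrite !inE => /andP[xP /eqP fx] /andP[yP /eqP fy].
by rewrite groupM // -(charN_mul S) // char_act_mul fx fy eqxx.
Qed.
Canonical fixP_group := Group fixP_group_set.

Lemma fixP_sub x : x \in fixP -> x \in P.
Proof. by rewrite inE => /andP[]. Qed.

(** The trace of [tau] on the coset module counts both the fixed points of [tau] in [N] and its
    fixed characters, so (iv) passes to the dual. *)
Lemma fixP_nontrivial : exists2 s, s \in fixP & s != 1%g.
Proof.
have tQ := ts_tau S; apply: contrapT => no.
have fixP1 x : x \in fixP -> x = 1%g.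
  by move=> xF; apply/eqP/negPn/negP=> x1; apply: no; exists x.
apply: (ts_fixN S); apply/eqP; rewrite eq_sym eqEcard cards1.
have -> : (#|('Fix_(N | 'J)[tau])%g| <= 1)%N; last first.
  rewrite andbT; apply/fintype.subsetP=> x /set1gP->;
    rewrite finset.in_setI group1.
  by apply/afix1P; rewrite /= conj1g.
have /natf_inj -> // : #|('Fix_(N | 'J)[tau])%g|%:R = 1%:R :> K.
transitivity (chi (gbase K (1 * tau)%g)).
  rewrite (coset_trace_base (ts_sdprod S)) ?group1 // -natr_sum -sum1_card.
  congr (_%:R); rewrite [RHS]big_mkcond [LHS]big_mkcond [RHS]big_mkcond /=.
  apply: eq_bigr => m _; rewrite finset.in_setI; case: (m \in N) => //=.
  rewrite (sameP afix1P eqP) conjVg [(1 == _)%g]eq_sym -eq_mulgV1 /=.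
  have -> : (m == m ^ tau^-1)%g = (m ^ tau == m)%g; last by case: eqP.
  by apply/eqP/eqP => mt; [rewrite {1}mt conjgKV | rewrite -{2}mt conjgK].
rewrite mul1g -[[tau]]mul1r -(idemN_sum1 S) mulr_suml.
under eq_bigr do rewrite mulr_suml.
rewrite pair_big /= (scalar_sum (@coset_trace_scalar gT N Q K)).
rewrite (bigD1 (1%g, 1%g)) ?group1 //= big1 ?addr0 =>
  [|[x y] /= /andP[/andP[xP yP] neq]].
  by rewrite coset_trace_idemN ?group1 // (charN1 S) char_act_trivial ?eqxx //
    (Q_norm_N S).
rewrite coset_trace_idemN //; case: eqP => // fix_xy.
have Exy := charN_fix_tau S xP yP fix_xy; move: fix_xy neq; rewrite -Exy => fx.
by rewrite [x]fixP1 ?eqxx // inE xP fx eqxx.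
Qed.

End OrderContainsGroup.

(** * Elements of an arbitrary Hopf order *)

Section TwistedOrder.
Variables (K : fieldExtType rat) (gT : finGroupType) (N Q L P : {group gT})
  (tau : gT) (f : gT -> {ffun gT -> K}).
Hypothesis S : twist_setting N Q L P tau f.
Local Notation KG := (galg K gT).
Local Notation O := (@algebraic_integer K).
Local Notation "[ g ]" := (gbase K g) (at level 0, g at level 99, format "[ g ]").
Local Notation E := (idemL L f).
Local Notation eN := (idemN L tau f).
Local Notation nu := (charN N L tau f).
Local Notation T := (comatrix L tau f).
Local Notation chi := (@coset_trace gT N Q K).
Local Notation F := (fixP N L P tau f).

Lemma idemN_conj x y q : x \in P -> y \in P -> q \in Q ->
  [q] * eN x y = char_idem N (char_act q (nu x y)) * [q].
Proof.
by move=> xP yP qQ; rewrite -(char_idem_charN S) // char_idem_conj //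
  (Q_norm_N S).
Qed.

(** Elements of [P] commute with [L], so they preserve the restriction to [L], which is recorded by
    [x]. *)
Lemma char_act_charN_L q x y : q \in P -> x \in P -> y \in P ->
  exists2 z, z \in P & char_act q (nu x y) = nu x z.
Proof.
move=> qP xP yP; have qN := Q_norm_N S (P_sub_Q S qP).
have [w [z [wP zP E_act]]] := dualN_charN S (dual_act qN (charN_dual S xP yP)).
exists z => //; rewrite E_act; congr nu; apply: (iso_inj S) => //;
  apply/ffunP=> l.
case: (boolP (l \in L)) => lL; last by rewrite !(iso_out S).
rewrite -(charN_L S w zP lL) -E_act ffunE -[in RHS](charN_L S x yP lL).
by congr (charN _ _ _ _ _ _ _); rewrite conjgE -(mulPLC S qP lL) mulKg.
Qed.

(** If p and q differ, then s = p^-1 q fixes [nu x x], and so does s tau s^-1; the second half of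
    (v) makes this character trivial. *)
Lemma P_act_inj p q x : p \in P -> q \in P -> x \in F -> x != 1%g ->
  char_act p (nu x x) = char_act q (nu x x) -> p = q.
Proof.
move=> pP qP; rewrite inE => /andP[xP /eqP fx] x1 Epq.
apply/eqP; rewrite eq_mulVg1; apply: contraNT x1 => pq1.
have sP : (p^-1 * q)%g \in P by rewrite groupM ?groupV.
have [_ fixE] := ts_fix_dual S sP pq1.
set s := (p^-1 * q)%g in sP pq1 fixE.
have fs : char_act s (nu x x) = nu x x.
  by rewrite char_actM -Epq char_actK.
have fsV : char_act s^-1 (nu x x) = nu x x by rewrite -{1}fs char_actK.
have : [set trivial_char K N] (nu x x).
  rewrite -fixE; split; split; rewrite //; try exact: (charN_dual S).
  by rewrite char_actM fsV char_actM fx fs.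
rewrite -(charN1 S) => /(charN_inj S)[] //; rewrite ?group1 //.
by move=> -> _; rewrite eqxx.
Qed.

(** The orbit of [nu x x] under [P] is free and stays among the [#|P|] characters [nu x z], so it
    exhausts them; their idempotents add up to [E x]. *)
Lemma act_idemN_sum x : x \in F -> x != 1%g ->
  \sum_(p in P) char_idem N (char_act p (nu x x)) = E x.
Proof.
move=> xF x1; have xP := fixP_sub xF.
(* The default 1 is never reached for [p] in [P], by [char_act_charN_L]. *)
pose y p := odflt 1%g [pick z in P | char_act p (nu x x) == nu x z].
have yP p : p \in P -> y p \in P /\ char_act p (nu x x) = nu x (y p).
  move=> pP; rewrite /y; case: pickP => [z /andP[zP /eqP ->] //|no].
  have [z zP Ez] := char_act_charN_L pP xP xP.
  by have := no z; rewrite /= zP Ez eqxx.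
have y_inj : {in P &, injective y}.
  move=> p q pP qP Epq; apply: (P_act_inj pP qP xF x1).
  by rewrite (yP p pP).2 (yP q qP).2 Epq.
have yPP : [set y p | p in P]%SET = P :> {set gT}.
  apply/eqP; rewrite eqEcard card_in_imset // leqnn andbT.
  by apply/fintype.subsetP=> z /imsetP[p pP ->]; have [] := yP p pP.
transitivity (\sum_(z in P) eN x z).
  rewrite -[in RHS]yPP big_imset //=; apply: eq_bigr => p pP.
  by have [ypP ->] := yP p pP; rewrite (char_idem_charN S).
rewrite -mulr_sumr -mulr_suml -mulr_sumr (idemL_sum1 S) mulr1 gbaseVr.
by rewrite mulr1.
Qed.

Variable Z : set KG.
Hypotheses (orderZ : reflexive_order Z)
  (ZJ : forall z, Z z -> order_square Z (comulJ L P f z)).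

Lemma order_P p : p \in P -> Z [p].
Proof.
move=> pP; apply: (grouplike_order orderZ (comulJ_linear _ _ _) ZJ).
  exact: comulJ_base S _ pP.
exact: gcounit_base.
Qed.

Lemma order_comatrix_trace : Z (\sum_(i in finset.setX P P) T i i).
Proof.
apply: (comatrix_trace_order orderZ (comulJ_linear _ _ _) ZJ).
  exact: (comulJ_comatrix S).
exact: (gcounit_comatrix S).
Qed.

(** If tau p fixes nu, then p tau fixes p nu; for p different from 1 the first half of (v) forces nu
    to be trivial. *)
Lemma char_act_tau_fix x y p : x \in P -> y \in P -> p \in P ->
  (char_act (tau * p) (nu x y) == nu x y) =
  ((x == 1%g) && (y == 1%g)) || [&& x == y, x \in F & p == 1%g].
Proof.
move=> xP yP pP; have tpQ : (tau * p)%g \in Q by rewrite groupM ?(ts_tau S)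
  ?(P_sub_Q S).
have [/andP[/eqP-> /eqP->]|] := boolP ((x == 1%g) && (y == 1%g)) => /=.
  by rewrite (charN1 S) char_act_trivial ?eqxx // (Q_norm_N S).
move=> xy1; have [->|p1] := eqVneq p 1%g.
  rewrite mulg1 andbT; apply/eqP/andP => [fx|[/eqP <-]].
    have Exy := charN_fix_tau S xP yP fx; rewrite Exy eqxx; split=> //.
    by rewrite inE yP -{1}Exy fx Exy eqxx.
  by rewrite inE => /andP[_ /eqP].
rewrite !andbF; apply/eqP=> fx.
have [fixE _] := ts_fix_dual S pP p1.
have : dual_fix N (p * tau)%g (char_act p (nu x y)).
  split; first by apply: dual_act; rewrite ?(Q_norm_N S) ?(P_sub_Q S) //;
    apply: (charN_dual S).
  by rewrite -char_actM -mulgA char_actM fx.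
rewrite fixE /= => /(congr1 (char_act p^-1)); rewrite char_actK.
rewrite char_act_trivial ?groupV ?(Q_norm_N S) ?(P_sub_Q S) // -(charN1 S).
move=> /(charN_inj S)[] //; rewrite ?group1 // => E1 E2.
by rewrite E1 E2 eqxx in xy1.
Qed.

(* [delta] is obtained from the character of the matrix coalgebra [K[M tau M]]
   by applying [chi] to one leg of its coproduct, where [chi (e_nu q)] is [1] if
   [q] fixes [nu] and [0] otherwise. Its terms are pairwise orthogonal and
   [p tau p^-1] fixes the character [p nu], so its [#[tau]]-th power is an
   idempotent. *)
Definition delta_term (p x : gT) : KG := [p] * eN x x * [tau * p^-1].
Definition delta : KG := \sum_(p in P) \sum_(x in F | x != 1%g) delta_term p x.

Lemma sum_P_shift (b d : gT) (G : gT * gT -> KG) : b \in P -> d \in P ->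
  \sum_(i in finset.setX P P) G i =
  \sum_(x in P) \sum_(y in P) G ((b * x^-1)%g, (y * d)%g).
Proof.
move=> bP dP; rewrite big_setX (reindex_inj (inj_comp (mulgI b) invg_inj)).
rewrite [LHS](eq_bigl (mem P)) => [|x]; last by rewrite /= groupMl ?groupV.
apply: eq_bigr => x xP; rewrite (reindex_inj (mulIg d)).
by rewrite [LHS](eq_bigl (mem P)) => [|y]; last by rewrite /= groupMr.
Qed.

(** The coproduct of the character is the sum of the [T i j] (x) [T j i]. By cyclicity of the trace,
    [chi (T i j)] tests whether some element of tau P fixes a character of [N], which
    [char_act_tau_fix] decides. *)
Lemma contract_comatrix_trace :
  contract chi (comulJ L P f (\sum_(i in finset.setX P P) T i i)) =
  \sum_(j in finset.setX P P) T j j + delta.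
Proof.
have chiP := @coset_trace_scalar gT N Q K.
rewrite !linear_sum /=.
transitivity (\sum_(i in finset.setX P P) \sum_(j in finset.setX P P)
    chi (T i j) *: T j i).
  apply: eq_bigr => i iP; rewrite (comulJ_comatrix S) // linear_sum.
  by apply: eq_bigr => j _; rewrite /= contractE.
rewrite exchange_big /=.
pose V b d x : KG := [b] * eN x^-1 x^-1 * [tau * d].
transitivity (\sum_(j in finset.setX P P) (T j j +
    \sum_(x in F | x != 1%g)
      (if (j.2 * j.1)%g == 1%g then V j.1 j.2 x else 0))).
  apply: eq_bigr => -[b d] /finset.setXP[bP dP] /=;
    rewrite (sum_P_shift _ bP dP).
  pose W x y : KG := [b] * eN x^-1 y^-1 * [tau * d].
  (* The trace is 1 for x = y = 1, which leaves [T j j], and for x = y nontrivial in [F] with d b =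
     1, which leaves a term of [delta]; it is 0 otherwise. *)
  transitivity (\sum_(x in P) \sum_(y in P)
     (((x == 1%g) && (y == 1%g))%:R *: W x y +
      [&& x != 1%g, x == y, x \in F & (d * b)%g == 1%g]%:R *: W x y)).
    apply: eq_bigr => x xP; apply: eq_bigr => y yP.
    have ydP : (y * d)%g \in P by rewrite groupM.
    have bxP : (b * x^-1)%g \in P by rewrite groupM ?groupV.
    have E1 : ((b * x^-1)^-1 * b = x)%g by rewrite invMg invgK mulgKV.
    have E2 : (d * (y * d)^-1 = y^-1)%g by rewrite invMg mulKVg.
    have TW : T (b, d) ((b * x^-1)%g, (y * d)%g) = W x y.
      by rewrite comatrixE /= (mulKg b) E2.
    have TX : T ((b * x^-1)%g, (y * d)%g) (b, d) =
      [b * x^-1] * eN x y * [tau * (y * d)].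
      by rewrite comatrixE /= E1 (mulgK d).
    rewrite TW TX.
    rewrite -mulrA (@coset_traceC _ _ _ (ts_sdprod S)) -mulrA gbaseM -mulgA.
    rewrite (coset_trace_idemN S) ?groupM ?(ts_tau S) ?(P_sub_Q S) ?groupV //.
    rewrite char_act_tau_fix ?groupM ?groupV //= -scalerDl -natrD;
      congr (_%:R *: _).
    have [->|x1] := eqVneq x 1%g => /=.
      by rewrite [(1 == y)%g]eq_sym addn0; case: (y == 1%g).
    case: eqP => //= <-; case: (x \in F) => //=; congr (nat_of_bool _).
    by rewrite -mulgA (mulPC S) ?groupM ?groupV // -!mulgA mulVg mulg1.
  have split2 (G H : gT -> gT -> KG) :
      \sum_(x in P) \sum_(y in P) (G x y + H x y) =
      \sum_(x in P) \sum_(y in P) G x y + \sum_(x in P) \sum_(y in P) H x y.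
    by rewrite -big_split; apply: eq_bigr => x _; rewrite -big_split.
  apply: etrans (split2 _ _) _; congr (_ + _).
    rewrite (bigD1 1%g) ?group1 //= [X in _ + X = _]big1; last first.
      by move=> x /andP[_ /negPf x1]; rewrite big1 // => y _;
        rewrite x1 scale0r.
    rewrite addr0 (bigD1 1%g) ?group1 //= [X in _ + X = _]big1; last first.
      by move=> y /andP[_ /negPf y1]; rewrite y1 andbF scale0r.
    rewrite addr0 eqxx scale1r comatrixE /= mulVg mulgV.
    by rewrite /W !invg1.
  rewrite [RHS](eq_bigl (fun x => (x \in P) && ((x \in F) && (x != 1%g)))) =>
    [|x]; last first.
    by case: (boolP (x \in F)) => [/fixP_sub->|]; rewrite ?andbF.
  rewrite [RHS]big_mkcondr; apply: eq_bigr => x xP.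
  rewrite (bigD1 x) //= big1 ?addr0 => [|y /andP[_ /negPf yx]]; last first.
    by rewrite [x == y]eq_sym yx andbF scale0r.
  rewrite eqxx /W /V; case: (x \in F); case: (x == 1%g); case: (_ == 1%g);
    by rewrite /= ?scale1r ?scale0r.
rewrite big_split; congr (_ + _); rewrite big_setX; apply: eq_bigr => b bP.
rewrite (bigD1 b^-1%g) ?groupV //= [X in _ + X]big1 ?addr0; last first.
  move=> d /andP[_ db]; rewrite big1 // => x _; case: eqP => // E1.
  by case/eqP: db; apply: (mulIg b); rewrite E1 mulVg.
transitivity (\sum_(x in F | x != 1%g) V b b^-1%g x).
  by apply: eq_bigr => x _; rewrite mulVg eqxx.
(* [F] is a group, so [x] may be replaced by its inverse. *)
rewrite [LHS](reindex_inj invg_inj).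
apply: eq_big => [x|x _]; last by rewrite /V invgK.
by rewrite (groupV (fixP_group S)) eq_invg1.
Qed.

Lemma order_delta : Z delta.
Proof.
have := contract_order orderZ (coset_trace_integral (ts_sdprod S) orderZ)
  (ZJ order_comatrix_trace).
rewrite contract_comatrix_trace => Zr.
by have := in_orderB orderZ Zr order_comatrix_trace; rewrite addrC addKr.
Qed.

End TwistedOrder.

(** * Idempotents and group elements in an arbitrary Hopf order *)

Section TwistedOrderContent.
Variables (K : fieldExtType rat) (gT : finGroupType) (N Q L P : {group gT})
  (tau : gT) (f : gT -> {ffun gT -> K}).
Hypothesis S : twist_setting N Q L P tau f.
Local Notation KG := (galg K gT).
Local Notation O := (@algebraic_integer K).
Local Notation "[ g ]" := (gbase K g) (at level 0, g at level 99, format "[ g ]").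
Local Notation E := (idemL L f).
Local Notation eN := (idemN L tau f).
Local Notation nu := (charN N L tau f).
Local Notation F := (fixP N L P tau f).

Let term (p x : gT) n : KG :=
  char_idem N (char_act p (nu x x)) * [p * tau ^+ n * p^-1].

Lemma delta_termE p x : p \in P -> x \in P -> delta_term L tau f p x =
  term p x 1.
Proof.
move=> pP xP; rewrite /delta_term (idemN_conj S xP xP (P_sub_Q S pP)) /term.
by rewrite -mulrA gbaseM expg1 mulgA.
Qed.

Lemma termC p x n : p \in P -> x \in F ->
  [p * tau ^+ n * p^-1] * char_idem N (char_act p (nu x x)) = term p x n.
Proof.
move=> pP xF; have fx : char_act tau (nu x x) = nu x x by move: xF;
  rewrite inE => /andP[_ /eqP].
have pN := Q_norm_N S (P_sub_Q S pP).
have fxn : char_act (p * tau ^+ n * p^-1)%g (char_act p (nu x x)) =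
  char_act p (nu x x).
  rewrite -char_actM mulgKV char_actM; congr char_act.
  by elim: n => [|n IHn]; rewrite ?char_act1 // expgS char_actM IHn.
by rewrite char_idem_conj ?fxn // !groupM ?groupV // groupX //
  (Q_norm_N S (ts_tau S)).
Qed.

Lemma termM p x q y m n : p \in P -> q \in P -> x \in F -> y \in F ->
  x != 1%g ->
  term p x m * term q y n = if (p == q) &&
    (x == y) then term p x (m + n) else 0.
Proof.
move=> pP qP xF yF x1; have [xP yP] := (fixP_sub xF, fixP_sub yF).
have [pN qN] := (Q_norm_N S (P_sub_Q S pP), Q_norm_N S (P_sub_Q S qP)).
have dx := dual_act pN (charN_dual S xP xP).
have dy := dual_act qN (charN_dual S yP yP).
rewrite -[term p x m]termC // /term -mulrA
  (mulrA (char_idem N (char_act p (nu x x)))).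
rewrite char_idemM //.
(* If the characters agree, restriction to [L] gives x = y, and then freeness of the action of [P]
   gives p = q. *)
have [Eact|neq] := eqVneq (char_act p (nu x x)) (char_act q (nu y y)).
  have Exy : x = y.
    have [z zP Ez] := char_act_charN_L S pP xP xP.
    have [w wP Ew] := char_act_charN_L S qP yP yP.
    by move: Eact; rewrite Ez Ew => /(charN_inj S)[].
  have Epq : p = q by apply: (P_act_inj S pP qP xF x1); rewrite Eact Exy.
  rewrite -Exy -Epq !eqxx /= mulrA termC // /term -mulrA gbaseM;
    congr (_ * [_]).
  by rewrite expgD !mulgA mulgKV.
rewrite mul0r mulr0; case: ifP => // /andP[/eqP Epq /eqP Exy].
by rewrite Epq Exy eqxx in neq.
Qed.

Lemma deltaX n : delta N L P tau f ^+ n.+1 =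
  \sum_(p in P) \sum_(x in F | x != 1%g) term p x n.+1.
Proof.
elim: n => [|n IHn].
  apply: eq_bigr => p pP; apply: eq_bigr => x /andP[xF _].
  by rewrite delta_termE ?(fixP_sub xF).
rewrite exprSr IHn /delta.
under [in X in _ * X]eq_bigr => p pP do
  under eq_bigr => x xF do rewrite delta_termE ?(fixP_sub (proj1 (andP xF))) //.
rewrite !pair_big /= big_distrlr /=;
  apply: eq_bigr => -[p x] /= /and3P[pP xF x1].
rewrite (bigD1 (p, x)) /= ?pP ?xF //= big1 ?addr0.
  by rewrite termM // !eqxx addn1.
move=> [q y] /= /andP[/and3P[qP yF y1] neq]; rewrite termM //.
case: ifP => // /andP[/eqP Epq /eqP Exy].
by rewrite Epq Exy eqxx in neq.
Qed.

Lemma delta_order : delta N L P tau f ^+ #[tau]%g =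
  \sum_(x in F | x != 1%g) E x.
Proof.
case o: #[tau]%g (order_gt0 tau) => [|n] // _; rewrite deltaX exchange_big /=.
apply: eq_bigr => x /andP[xF x1]; rewrite -(act_idemN_sum S xF x1).
apply: eq_bigr => p pP; rewrite /term -o expg_order mulg1 mulgV.
exact: mulr1.
Qed.

Variable Z : set KG.
Hypotheses (orderZ : reflexive_order Z)
  (ZJ : forall z, Z z -> order_square Z (comulJ L P f z)).

(* [\sum_x v x *: E x] is a function on the characters of [L]; its translates
   are obtained by evaluating one leg of its coproduct, where evaluations are
   integral because values of elements of the order are eigenvalues. *)
Lemma order_translate (v : gT -> K) y : y \in P ->
  Z (\sum_(x in P) v x *: E x) -> Z (\sum_(x in P) v (y * x)%g *: E x).
Proof.
move=> yP Zv; apply: (mem_order orderZ) => phi phiP.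
have phil := phiP.1; rewrite scalar_sumZ //.
have Zw := contract_order orderZ phiP (ZJ Zv).
(* [E y] is an eigenvector of the contracted coproduct, with [phi] of the translate as
   eigenvalue. *)
apply: (order_eigenvalue orderZ Zw (h := E y)).
  exact: char_idem_neq0 (iso_dual S yP).
rewrite !linear_sum /= mulr_suml scaler_suml.
transitivity (\sum_(z in P) \sum_(x in P)
  (if y == (z * x^-1)%g then (v z * phi (E x)) *: E y else 0)).
  apply: eq_bigr => z zP; rewrite linearZ /= linearZ /=.
  rewrite (comulJ_idemL S zP) (gcomul_idemL S zP)
    (linear_sum (contract phi)) /=.
  rewrite scaler_sumr mulr_suml.
  apply: eq_bigr => x xP; rewrite contractE // scalerA -scalerAl.
  rewrite (idemLM S) ?groupM ?groupV // eq_sym.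
  by case: eqP => [<-|_] //; rewrite scaler0.
rewrite exchange_big; apply: eq_bigr => x xP /=.
rewrite (bigD1 (y * x)%g) ?groupM //= mulgK eqxx big1 ?addr0 // =>
  z /andP[zP neq].
by case: eqP => // E1; rewrite E1 mulgKV eqxx in neq.
Qed.

(** Let u be the sum of the [E z] over [F] without 1, and u' its translate by some nontrivial s in
    [F], supported on [F] without s. Then u - u u' is [E s], whose translates are all the [E x]. *)
Lemma order_idemL x : x \in P -> Z (E x).
Proof.
move=> xP; have [s sF s1] := fixP_nontrivial S; have sP := fixP_sub sF.
have sum_ind (B : pred gT) : \sum_(z in P | B z) E z =
  \sum_(z in P) (B z)%:R *: E z.
  rewrite big_mkcondr; apply: eq_bigr => z _.
  by case: (B z); rewrite ?scale1r ?scale0r.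
pose B z := (z \in F) && (z != 1%g).
have Zu : Z (\sum_(z in P) (B z)%:R *: E z).
  have := in_orderX orderZ #[tau]%g (order_delta S orderZ ZJ).
  rewrite delta_order -sum_ind (eq_bigl (fun z => (z \in P) && B z)) // => z.
  by rewrite /B; case: (boolP (z \in F)) => [/fixP_sub->|_]; rewrite ?andbF.
have Zu' := order_translate (groupVr sP) Zu.
have Zs : Z (\sum_(z in P) (z == s)%:R *: E z).
  have := in_orderB orderZ Zu (in_orderM orderZ Zu Zu').
  congr (Z _); rewrite big_distrlr -sumrB /=; apply: eq_bigr => z zP.
  rewrite (bigD1 z) //= big1 ?addr0; last first.
    move=> w /andP[wP wz]; rewrite -(scalerAl (B z)%:R)
      -(scalerAr (B (s^-1 * w)%g)%:R).
    rewrite (idemLM S) // eq_sym (negPf wz).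
    by rewrite !scaler0.
  rewrite -(scalerAl (B z)%:R) -(scalerAr (B (s^-1 * z)%g)%:R)
    (idemLM S) // eqxx.
  rewrite (scalerA (B z)%:R (B (s^-1 * z)%g)%:R) -scalerBl; congr (_ *: _).
  rewrite /B; have [->|zs] := eqVneq z s.
    by rewrite sF s1 mulVg eqxx andbF mulr0 subr0.
  have -> : (s^-1 * z != 1)%g by rewrite -eq_mulVg1 eq_sym.
  rewrite (groupMl z (groupVr sF : _ \in fixP_group S)) andbT.
  case: (z \in F); rewrite /= ?mul0r ?subrr //.
  by case: (z != 1%g); rewrite ?mul0r ?mul1r ?mulr1 subrr.
(* Translation by this element moves the support from [s] to [x]. *)
have yP : (s * x^-1)%g \in P by rewrite groupM ?groupV.
have := order_translate yP Zs; congr (Z _).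
rewrite (bigD1 x) //= mulgKV eqxx scale1r big1 ?addr0 // => z /andP[zP neq].
case: eqP => [E1|_]; last by rewrite scale0r.
case/eqP: neq; apply: (mulgI x^-1%g); rewrite mulVg; apply: (mulgI s).
by rewrite mulgA E1 mulg1.
Qed.

Lemma order_twistJ : order_square Z (twistJ L P f).
Proof.
apply: order_square_sum => x xP; apply: order_square_gtens.
  exact: order_idemL.
exact: (order_P S orderZ ZJ).
Qed.

Lemma order_twistV : order_square Z (twistV L P f).
Proof.
apply: order_square_sum => x xP; apply: order_square_gtens.
  exact: order_idemL.
by apply: (order_P S orderZ ZJ); rewrite groupV.
Qed.

Lemma order_gcomul z : Z z -> order_square Z (gcomul z).
Proof.
move=> Zz; rewrite (gcomulE S); apply: (order_squareM orderZ);
  last exact: order_twistJ.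
by apply: (order_squareM orderZ); [apply: order_twistV | apply: ZJ].
Qed.

Lemma order_gbase g : Z [g].
Proof.
apply: (grouplike_order orderZ (@gcomul_linear _ _) order_gcomul).
  exact: gcomul_base.
exact: gcounit_base.
Qed.

Lemma order_char_idem psi : dual N psi -> Z (char_idem N psi).
Proof.
move=> /(dualN_charN S)[x [y [xP yP ->]]]; rewrite (char_idem_charN S) //.
rewrite /idemN /idemL_tau; do ?[apply: (in_orderM orderZ)].
- exact: order_idemL.
- exact: order_gbase.
- exact: order_idemL.
- exact: order_gbase.
Qed.

End TwistedOrderContent.

(** * The lattice spanned by the idempotents of KN and Q *)

Section FreeLattice.
Variables (R K : comNzRingType) (iota : {rmorphism R -> K}) (U : lmodType K).
Variables (n : nat) (b : 'I_n -> U) (c : 'I_n -> {scalar U}).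
Hypotheses (iota_inj : injective iota)
  (bc : forall x, x = \sum_i c i x *: b i)
  (cb : forall i j, c i (b j) = (i == j)%:R).

Definition lattice : set U := [set x | forall i, exists r, iota r = c i x].

Lemma lattice_basis i : lattice (b i).
Proof. by move=> j; exists (j == i)%:R; rewrite rmorph_nat cb. Qed.

Lemma lattice_coord :
  exists rho : U -> 'I_n -> R, forall x, lattice x -> forall i, iota (rho x i) =
    c i x.
Proof.
have /choice[rho rhoP] : forall x, exists r : 'I_n -> R, lattice x ->
  forall i, iota (r i) = c i x.
  move=> x; have [Lx|nLx] := pselect (lattice x); last by exists (fun=> 0).
  by have [r rP] := choice Lx; exists r.
by exists rho.
Qed.

Lemma lattice_submodule : is_submodule iota lattice.
Proof.
split=> [i|r x y Lx Ly i]; first by exists 0; rewrite rmorph0 linear0.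
have [[s sx] [t ty]] := (Lx i, Ly i); exists (r * s + t).
by rewrite rmorphD rmorphM sx ty linearP.
Qed.

Lemma lattice_finitely_generated : finitely_generated iota lattice.
Proof.
have [rho rhoP] := lattice_coord; exists n, b; split=> [|y Ly];
  first exact: lattice_basis.
by exists (rho y); rewrite {1}(bc y); apply: eq_bigr => i _; rewrite rhoP.
Qed.

Lemma linear_on_sum (V : lmodType R) (p : U -> V) (r : 'I_n -> R) :
  linear_on iota lattice p -> p (\sum_i iota (r i) *: b i) =
    \sum_i r i *: p (b i).
Proof.
move=> pl; have [L0 LD] := lattice_submodule.
(* Membership is carried through the induction, since [linear_on] speaks of elements of the lattice
   only. *)
suff [] : lattice (\sum_i iota (r i) *: b i) /\
    p (\sum_i iota (r i) *: b i) = \sum_i r i *: p (b i) by [].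
elim/big_rec2: _ => [|i v u _ [Lu <-]].
  by split=> //; have := pl (-1) 0 0 L0 L0;
    rewrite scaler0 addr0 scaleN1r addNr.
by split; [apply: LD (lattice_basis i) Lu | rewrite pl //;
  apply: lattice_basis].
Qed.

Lemma lattice_projective : projective iota lattice.
Proof.
move=> V W g p gsurj pl; have [rho rhoP] := lattice_coord.
have [v gv] := choice (fun i => gsurj (p (b i))).
have [_ LD] := lattice_submodule.
exists (fun x => \sum_i rho x i *: v i); split=> [r x y Lx Ly|x Lx].
  rewrite scaler_sumr -big_split; apply: eq_bigr => i _ /=.
  rewrite scalerA -scalerDl; congr (_ *: _); apply: iota_inj.
  by rewrite rmorphD rmorphM !rhoP ?linearP //; apply: LD.
rewrite linear_sum {2}(bc x).
under [in RHS]eq_bigr => i _ do rewrite -(rhoP x Lx).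
by rewrite linear_on_sum //; apply: eq_bigr => i _; rewrite linearZ /= gv.
Qed.

(** As the [b i] form a basis, a bilinear map [p] can only extend to the sum of the
    [p (b i) (c i x)]. *)
Lemma lattice_tensor :
  is_tensor_product iota lattice setT (fun (x : U) (k : K^o) => k *: x).
Proof.
split=> [r x x' k _ _ _|r x k k' _ _ _|V p pl pr].
- by rewrite scalerDr !scalerA mulrC.
- by rewrite scalerDl scalerA.
have [rho rhoP] := lattice_coord.
exists (fun x => \sum_i p (b i) (c i x)); split=> [|h [hl hp]].
  split=> [r x y _ _|x k Lx _].
    rewrite scaler_sumr -big_split; apply: eq_bigr => i _.
    by rewrite linearP pr //; apply: lattice_basis.
  have pk : linear_on iota lattice (p^~ k) := pl k I.
  transitivity (p (\sum_i iota (rho x i) *: b i) k).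
    rewrite (linear_on_sum _ pk); apply: eq_bigr => i _.
    have bi := lattice_basis i; have p0 : p (b i) 0 = 0.
      by have := pr _ bi (-1) 0 0 I I; rewrite scaler0 addr0 scaleN1r addNr.
    rewrite linearZ /= -rhoP // mulrC.
    by have := pr _ bi (rho x i) k 0 I I; rewrite !addr0 p0 addr0.
  by congr (p _ k); rewrite [RHS]bc; apply: eq_bigr => i _; rewrite rhoP.
apply/funext => x; rewrite [in RHS](bc x).
have h0 : h 0 = 0.
  by have := hl (-1) 0 0 I I; rewrite scaler0 addr0 scaleN1r addNr.
elim/big_rec2: _ => [|i u v _ ->]; first by rewrite h0.
have := hl 1 (c i x *: b i) u I I; rewrite rmorph1 !scale1r => ->.
by rewrite hp //; apply: lattice_basis.
Qed.

End FreeLattice.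

Section ReflexiveHopfOrder.
Variables (K : fieldExtType rat) (A : algType K) (Z : set A).
Local Notation O := (@algebraic_integer K).
Local Notation iota := (val : {rmorphism ring_of_integers K -> K}).

Lemma reflexive_orderP : is_submodule iota Z -> finitely_generated iota Z ->
  projective iota Z -> is_tensor_product iota Z setT
    (fun (x : A) (k : K^o) => k *: x) ->
  Z 1 -> (forall x y, Z x -> Z y -> Z (x * y)) -> reflexive_order Z.
Proof.
move=> subZ fgZ projZ tensZ Z1 ZM; split=> // [k x y kO Zx Zy|].
  by have := subZ.2 (RingOfIntegers kO) x y Zx Zy.
have [m [b [phi [Zb phiZ bP]]]] := projective_dual_basis subZ fgZ projZ tensZ.
exists m, b, (fun i => phi i : A -> K); split=> // i; split=> [k x y|z Zz].
  exact: linearP.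
by have [r <-] := phiZ i z Zz; case: r.
Qed.

End ReflexiveHopfOrder.

(** * Coordinates, basis and product of the lattice *)

Section CrossedLattice.
Variables (K : fieldExtType rat) (gT : finGroupType) (N Q L P : {group gT})
  (tau : gT) (f : gT -> {ffun gT -> K}).
Hypothesis S : twist_setting N Q L P tau f.
Local Notation KG := (galg K gT).
Local Notation O := (@algebraic_integer K).
Local Notation iota := (val : {rmorphism ring_of_integers K -> K}).
Local Notation "[ g ]" := (gbase K g) (at level 0, g at level 99, format "[ g ]").
Local Notation e psi := (char_idem N psi : KG).
Local Notation nu := (charN N L tau f).
Local Notation eN := (idemN L tau f).

(* The coordinate of [u] along [e psi * [q]]. *)
Definition crossed_coord (psi : {ffun gT -> K}) (q : gT) (u : KG) : K :=
  \sum_(n in N) psi n * u (n * q)%g.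

Lemma crossed_coord_scalar psi q : scalar (crossed_coord psi q).
Proof.
move=> k u v; rewrite /crossed_coord mulr_sumr -big_split;
  apply: eq_bigr => n _.
by rewrite galgDE galgZE mulrDr mulrCA.
Qed.
HB.instance Definition _ psi q :=
  GRing.isLinear.Build _ _ _ _ (crossed_coord psi q)
    (crossed_coord_scalar psi q).

Lemma crossed_coord_base psi q m r : m \in N -> r \in Q -> q \in Q ->
  crossed_coord psi q [m * r] = if q == r then psi m else 0.
Proof.
move=> mN rQ qQ; case: eqP => [->|qr].
  rewrite /crossed_coord (bigD1 m) //= ffunE eqxx mulr1 big1 ?addr0 // =>
    n /andP[_ nm].
  by rewrite ffunE (inj_eq (mulIg r)) (negPf nm) mulr0.
rewrite /crossed_coord big1 // => n nN; rewrite ffunE.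
case: eqP => [E1|_]; last by rewrite mulr0.
case: qr; have E2 : (m^-1 * n = r * q^-1)%g.
  by apply: (mulgI m); rewrite mulKVg mulgA -E1 mulgK.
have mnN : (m^-1 * n)%g \in N by rewrite groupM ?groupV.
have mnQ : (m^-1 * n)%g \in Q by rewrite E2 groupM ?groupV.
apply: (mulIg q^-1%g); rewrite mulgV -E2.
by rewrite (sdprod_TI (ts_sdprod S) mnN mnQ).
Qed.

Lemma char_idem_gbase psi q :
  e psi * [q] = #|N|%:R^-1 *: \sum_(m in N) psi m^-1%g *: [m * q].
Proof.
rewrite -scalerAl mulr_suml; congr (_ *: _); apply: eq_bigr => m _.
by rewrite -scalerAl gbaseM.
Qed.

Lemma crossed_coord_idem psi phi q r : dual N psi -> dual N phi -> q \in Q ->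
  r \in Q ->
  crossed_coord psi q (e phi * [r]) = ((psi == phi) && (q == r))%:R.
Proof.
move=> psiP phiP qQ rQ; rewrite char_idem_gbase linearZ linear_sum /=.
case: (eqVneq q r) => [->|qr]; last first.
  rewrite andbF big1 ?mulr0 // => m mN.
  by rewrite linearZ /= crossed_coord_base // (negPf qr) mulr0.
rewrite andbT; transitivity (#|N|%:R^-1 * \sum_(m in N) psi m * phi m^-1%g).
  congr (_ * _); apply: eq_bigr => m mN.
  by rewrite linearZ /= crossed_coord_base // eqxx mulrC.
by rewrite dual_orthogonality //; case: eqP;
  rewrite ?mulr0 // mulVf ?cardG_neq0.
Qed.

Lemma crossed_expansion u :
  u = \sum_(psi <- charsN N L P tau f) \sum_(q in Q) crossed_coord psi q
    u *: (e psi * [q]).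
Proof.
apply: (galg_eq_linear (f := id) (f' :=
  fun u => \sum_(psi <- charsN N L P tau f)
    \sum_(q in Q) crossed_coord psi q u *: (e psi * [q]))) =>
      [k x y|k x y|g] //.
  rewrite scaler_sumr -big_split; apply: eq_bigr => psi _.
  rewrite scaler_sumr -big_split; apply: eq_bigr => q _.
  by rewrite linearP scalerDl scalerA.
have [m [r [mN rQ ->]]] := sdprod_split (ts_sdprod S) g.
rewrite -[in LHS]gbaseM (split_dual_gbase (split_dual_N S) mN) mulr_suml.
apply: eq_bigr => psi _; rewrite (bigD1 r) //= big1 ?addr0 => [|q /andP[qQ qr]].
  by rewrite crossed_coord_base // eqxx scalerAl.
by rewrite crossed_coord_base // (negPf qr) scale0r.
Qed.

(** The span over the ring of integers of the [e psi * [q]], described by coordinates. *)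
Definition crossed_lattice : set KG :=
  [set u | forall psi q, dual N psi -> q \in Q -> crossed_coord psi q u \in O].

Local Notation I3 := (finset.setX (finset.setX P P) Q).
Let bI (i : 'I_#|I3|) : KG :=
  let: (x, y, q) := enum_val i in eN x y * [q].
Let cI (i : 'I_#|I3|) : {scalar KG} :=
  crossed_coord (nu (enum_val i).1.1 (enum_val i).1.2) (enum_val i).2.

Let I3P (i : 'I_#|I3|) :
  [/\ (enum_val i).1.1 \in P, (enum_val i).1.2 \in P & (enum_val i).2 \in Q].
Proof.
by have := enum_valP i; case: (enum_val i) =>
  -[x y] q /finset.setXP[/finset.setXP[]].
Qed.

Let bIE i : bI i = e (nu (enum_val i).1.1 (enum_val i).1.2) * [(enum_val i).2].
Proof.
have [xP yP _] := I3P i; rewrite (char_idem_charN S) //.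
by rewrite /bI; case: (enum_val i) => -[].
Qed.

Let bcI u : u = \sum_i cI i u *: bI i.
Proof.
rewrite [LHS]crossed_expansion sum_charsN.
under [RHS]eq_bigr do rewrite bIE.
transitivity (\sum_(i in I3)
    crossed_coord (nu i.1.1 i.1.2) i.2 u *: (e (nu i.1.1 i.1.2) * [i.2])).
  by rewrite !big_setX.
by rewrite big_enum_val.
Qed.

Let cbI i j : cI i (bI j) = (i == j)%:R.
Proof.
have [[xP yP qQ] [x'P y'P q'Q]] := (I3P i, I3P j).
rewrite bIE /= crossed_coord_idem //; try exact: (charN_dual S).
rewrite -(inj_eq enum_val_inj); congr (nat_of_bool _)%:R.
move: xP yP qQ x'P y'P q'Q;
  case: (enum_val i) (enum_val j) => -[x y] q [[x' y'] q'] /=.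
move=> xP yP qQ x'P y'P q'Q; rewrite !xpair_eqE; congr (_ && _).
by apply/eqP/andP => [/(charN_inj S)[] // -> ->|[/eqP-> /eqP->]].
Qed.

Let iota_inj : injective iota. Proof. exact: val_inj. Qed.

Lemma crossed_latticeE : crossed_lattice = lattice iota cI.
Proof.
apply/seteqP; split=> u uP => [i|psi q /(dualN_charN S)[x [y [xP yP ->]]] qQ].
  have [xP yP qQ] := I3P i.
  by exists (RingOfIntegers (uP _ _ (charN_dual S xP yP) qQ)).
have iI : (x, y, q) \in I3 by rewrite !finset.in_setX xP yP.
have [r] := uP (enum_rank_in iI (x, y, q)).
by rewrite /= enum_rankK_in //= => <-; case: r.
Qed.

Lemma crossed_submodule : is_submodule iota crossed_lattice.
Proof. by rewrite crossed_latticeE; apply: lattice_submodule. Qed.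

Lemma crossed_fg : finitely_generated iota crossed_lattice.
Proof. by rewrite crossed_latticeE;
  apply: lattice_finitely_generated bcI cbI. Qed.

Lemma crossed_projective : projective iota crossed_lattice.
Proof. by rewrite crossed_latticeE;
  apply: lattice_projective iota_inj bcI cbI. Qed.

Lemma crossed_tensor :
  is_tensor_product iota crossed_lattice setT
    (fun (x : KG) (k : K^o) => k *: x).
Proof. by rewrite crossed_latticeE; apply: lattice_tensor bcI cbI. Qed.

Lemma crossed_lattice_gen psi q : dual N psi -> q \in Q ->
  crossed_lattice (e psi * [q]).
Proof.
move=> psiP qQ phi r phiP rQ; rewrite crossed_coord_idem //.
by case: (_ && _); rewrite ?rpred1 ?rpred0.
Qed.

Lemma crossed_lattice_sum (I : Type) (s : seq I) (B : pred I) (F : I -> KG) :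
  (forall i, B i -> crossed_lattice (F i)) ->
    crossed_lattice (\sum_(i <- s | B i) F i).
Proof.
move=> FL psi q psiP qQ; rewrite linear_sum; apply: rpred_sum => i Bi.
exact: FL.
Qed.

Lemma crossed_latticeZ k u : k \in O -> crossed_lattice u ->
  crossed_lattice (k *: u).
Proof.
by move=> kO uL psi q psiP qQ; rewrite linearZ /=; apply: rpredM => //;
  apply: uL.
Qed.

(** Moving [[q]] past [e phi] replaces [phi] by its image under [q], so a product of two basis
    elements is a basis element or 0. *)
Lemma crossed_latticeM u v : crossed_lattice u -> crossed_lattice v ->
  crossed_lattice (u * v).
Proof.
move=> uL vL; rewrite (crossed_expansion u) (crossed_expansion v).
have charP psi : psi \in charsN N L P tau f -> dual N psi.
  by case: (split_dual_N S) => _ + _; apply.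
rewrite mulr_suml big_seq; apply: crossed_lattice_sum => psi /charP psiP.
rewrite mulr_sumr big_seq; apply: crossed_lattice_sum => phi /charP phiP.
rewrite mulr_suml; apply: crossed_lattice_sum => q qQ.
rewrite mulr_sumr; apply: crossed_lattice_sum => r rQ.
rewrite -scalerAl -scalerAr; apply: crossed_latticeZ; first exact: uL.
apply: crossed_latticeZ; first exact: vL.
have qN := Q_norm_N S qQ; have qphiP := dual_act qN phiP.
rewrite -mulrA (mulrA [q]) char_idem_conj // !mulrA char_idemM //.
case: eqP => _; first by rewrite -mulrA gbaseM; apply: crossed_lattice_gen;
  rewrite ?groupM.
rewrite !mul0r => chi s _ _; rewrite linear0; exact: rpred0.
Qed.

Lemma crossed_lattice_idem psi : dual N psi -> crossed_lattice (e psi).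
Proof.
by move=> psiP; have := crossed_lattice_gen psiP (group1 Q);
  rewrite gbase1 mulr1.
Qed.

Lemma crossed_lattice1 : crossed_lattice 1.
Proof.
rewrite -(split_dual_sum1 (split_dual_N S)) big_seq;
  apply: crossed_lattice_sum => psi.
by case: (split_dual_N S) => _ + _ => /[apply]; apply: crossed_lattice_idem.
Qed.

Lemma crossed_lattice_base q : q \in Q -> crossed_lattice [q].
Proof.
move=> qQ; rewrite -[[q]]mul1r -(split_dual_sum1 (split_dual_N S)) mulr_suml
  big_seq.
apply: crossed_lattice_sum => psi.
by case: (split_dual_N S) => _ + _ => /[apply] psiP; apply: crossed_lattice_gen.
Qed.

Lemma crossed_subalgebra : is_subalgebra iota crossed_lattice.
Proof.
split; [exact: crossed_submodule | exact: crossed_lattice1 |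
  exact: crossed_latticeM].
Qed.

Definition crossed_generators : set KG :=
  [set x | (exists psi, dual N psi /\ x = e psi) \/ (exists q, q \in Q /\ x =
    [q])].

Lemma crossed_lattice_min (A : set KG) : is_subalgebra iota A ->
  crossed_generators `<=` A -> crossed_lattice `<=` A.
Proof.
move=> [[A0 AD] A1 AM] genA u uL; rewrite (crossed_expansion u).
have Asum (I : eqType) (s : seq I) (B : pred I) (F : I -> KG) :
    (forall i, i \in s -> B i -> A (F i)) -> A (\sum_(i <- s | B i) F i).
  move=> AF; rewrite big_seq_cond; elim/big_ind: _ => //;
    last by move=> i /andP[]; apply: AF.
  by move=> x y Ax Ay; have := AD 1 x y Ax Ay; rewrite rmorph1 scale1r.
apply: (Asum) => psi psis _; apply: (Asum) => q _ qQ.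
have psiP : dual N psi by case: (split_dual_N S) => _ + _; apply.
have := AD (RingOfIntegers (uL psi q psiP qQ)) (e psi * [q]) 0.
rewrite addr0; apply=> //; apply: AM; apply: genA; first by left; exists psi.
by right; exists q.
Qed.

Lemma subalgebra_generatedE : subalgebra_generated iota crossed_generators =
  crossed_lattice.
Proof.
apply/seteqP; split=> [u|u uL A [subA genA]].
  apply; split; first exact: crossed_subalgebra.
  move=> x [[psi [psiP ->]]|[q [qQ ->]]]; first exact: crossed_lattice_idem.
  exact: crossed_lattice_base.
exact: crossed_lattice_min.
Qed.

End CrossedLattice.

(** * Every Hopf order is contained in the lattice *)

Section CrossedMaximal.
Variables (K : fieldExtType rat) (gT : finGroupType) (N Q L P : {group gT})
  (tau : gT) (f : gT -> {ffun gT -> K}).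
Hypothesis S : twist_setting N Q L P tau f.
Local Notation KG := (galg K gT).
Local Notation O := (@algebraic_integer K).
Local Notation "[ g ]" := (gbase K g) (at level 0, g at level 99, format "[ g ]").
Local Notation e psi := (char_idem N psi : KG).
Local Notation charsN := (charsN N L P tau f).

Variable Z : set KG.
Hypotheses (orderZ : reflexive_order Z)
  (Zcomul : forall z, Z z -> order_square Z (gcomul z))
  (Zcounit : forall z, Z z -> gcounit z \in O)
  (Zidem : forall psi, dual N psi -> Z (e psi))
  (Zbase : forall q, q \in Q -> Z [q]).

(** The linear functional on KG that corresponds to the function [w] on the group. *)
Definition weight (w : gT -> K) (u : KG) : K := \sum_g (u g : K) * w g.

Lemma weight_scalar w : scalar (weight w).
Proof.
move=> k u v; rewrite /weight mulr_sumr -big_split; apply: eq_bigr => g _.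
by rewrite galgDE galgZE mulrDl -mulrA.
Qed.

Lemma weight_base w g : weight w [g] = w g.
Proof.
rewrite /weight (bigD1 g) //= ffunE eqxx mul1r big1 ?addr0 // => h /negPf hg.
by rewrite ffunE hg mul0r.
Qed.

Lemma eq_integral_on (phi psi : KG -> K) : integral_on Z phi -> phi =1 psi ->
  integral_on Z psi.
Proof. by move=> phiP /funext <-. Qed.

(* The convolution of functionals on the group algebra is the pointwise product
   of functions on the group. *)
Lemma weight_integralM w w' : integral_on Z (weight w) ->
  integral_on Z (weight w') ->
  integral_on Z (weight (fun g => w g * w' g)).
Proof.
move=> wP w'P; have := convolution_integral (@gcomul_linear K gT) Zcomul wP w'P.
move=> conv; apply: (eq_integral_on conv) => u.
have cl := conv.1; have wl := weight_scalar (fun g => w g * w' g).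
rewrite (galg_scalar u cl) (galg_scalar u wl); apply: eq_bigr => g _;
  congr (_ * _).
by rewrite gcomul_base (ftensE _ _ wP.1 w'P.1) !weight_base.
Qed.

Lemma weight_integral1 : integral_on Z (weight (fun=> 1)).
Proof.
apply: (@eq_integral_on (@gcounit K gT)); first by split=> // k u v;
  apply: gcounit_scalar.
by move=> u; apply: eq_bigr => g _; rewrite mulr1.
Qed.

Lemma weight_integral_prod (I : Type) (s : seq I) (w : I -> gT -> K) :
  (forall i, integral_on Z (weight (w i))) ->
  integral_on Z (weight (fun g => \prod_(i <- s) w i g)).
Proof.
move=> wP; elim: s => [|i s IHs].
  apply: eq_integral_on weight_integral1 _ => u.
  by apply: eq_bigr => g _; rewrite big_nil.
apply: eq_integral_on (weight_integralM (wP i) IHs) _ => u.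
by apply: eq_bigr => g _; rewrite big_cons.
Qed.

Definition stab (psi : {ffun gT -> K}) : {set gT} :=
  [set q in Q | char_act q psi == psi].

Lemma stab_group_set psi : group_set (stab psi).
Proof.
apply/group_setP; split=> [|q r]; first by rewrite inE group1 char_act1 eqxx.
rewrite !inE => /andP[qQ /eqP fq] /andP[rQ /eqP fr].
by rewrite groupM // char_actM fr fq eqxx.
Qed.
Canonical stab_group psi := Group (stab_group_set psi).

(** This is the function sending n q to psi(n) if q fixes psi and to 0 otherwise; see
    [stab_weightE]. *)
Definition stab_weight psi g : K :=
  \sum_(q in stab psi) crossed_coord N psi q [g].

Lemma stab_weightE psi m r : m \in N -> r \in Q ->
  stab_weight psi (m * r)%g = if r \in stab psi then psi m else 0.
Proof.
move=> mN rQ; rewrite /stab_weight.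
under eq_bigr => q do rewrite inE => /andP[qQ _].
case: ifP => rs; last first.
  rewrite big1 // => q; rewrite inE => /andP[qQ fq].
  rewrite (crossed_coord_base S) //; case: eqP rs => // <-.
  by rewrite inE qQ fq.
rewrite (bigD1 r) //= (crossed_coord_base S) // eqxx big1 ?addr0 // => q.
rewrite inE => /andP[/andP[qQ _] /negPf qr].
by rewrite (crossed_coord_base S) // qr.
Qed.

(* [e psi * Z * e psi] acts on [e psi * \sum_(q in stab psi) q] through the
   character [q |-> 1] of the stabilizer. *)
Lemma stab_weight_integral psi : dual N psi ->
  integral_on Z (weight (stab_weight psi)).
Proof.
move=> psiP; split=> [|x Zx]; first exact: weight_scalar.
pose s := \sum_(r in stab psi) [r]; pose h : KG := e psi * s.
have hs r : r \in stab psi -> [r] * s = s.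
  move=> rs; rewrite /s mulr_sumr [RHS](reindex_inj (mulgI r)).
  by apply: eq_big => [q|q _];
    rewrite ?gbaseM // (groupMl _ (rs : r \in stab_group psi)).
apply: (order_eigenvalue orderZ (in_orderM orderZ (Zidem psiP) Zx) (h := h)).
  (* [h] is nonzero because its coordinate at [psi] and 1 is 1. *)
  apply/eqP => /(congr1 (crossed_coord N psi 1%g)).
  rewrite linear0 /h /s mulr_sumr linear_sum /=.
  rewrite (bigD1 1%g) ?group1 //= (crossed_coord_idem S) ?group1 // !eqxx.
  rewrite big1 => [|q /andP[]]; first by rewrite addr0; apply/eqP/oner_neq0.
  rewrite inE => /andP[qQ _] q1; rewrite (crossed_coord_idem S) ?group1 //.
  by rewrite [(1 == q)%g]eq_sym (negPf q1) andbF.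
apply: (galg_eq_linear (f := fun x => e psi * x * h)
  (f' := fun x => weight (stab_weight psi) x *: h)) => [k u v|k u v|g].
- by rewrite mulrDr mulrDl -scalerAr -scalerAl.
- by rewrite weight_scalar scalerDl scalerA.
have [m [r [mN rQ ->]]] := sdprod_split (ts_sdprod S) g.
rewrite weight_base stab_weightE // -gbaseM mulrA char_idemMr //.
rewrite -(scalerAl (psi m) (e psi)) -(scalerAl (psi m) (e psi * [r])).
have rN := Q_norm_N S rQ.
have -> : e psi * [r] * h = if r \in stab psi then h else 0.
  rewrite /h mulrA -(mulrA _ [r]) char_idem_conj // mulrA
    (char_idemM psiP (dual_act rN psiP)).
  rewrite inE rQ eq_sym /=; case: eqP => [E1|_]; last by rewrite !mul0r.
  by rewrite -mulrA hs // inE rQ E1 eqxx.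
by case: (r \in stab psi); rewrite ?scaler0 ?scale0r.
Qed.

(** An element of [N] is determined by the values of all characters, so such a [q] centralizes [N],
    and the action is faithful. *)
Lemma stab_bigcap q : q \in Q ->
  (forall psi, psi \in charsN -> q \in stab psi) -> q = 1%g.
Proof.
move=> qQ fq; have /faithfulP faith := ts_faithful S;
  apply: faith => // n nN /=.
have gbase_inj g h : [g] = [h] -> g = h.
  by move=> /ffunP/(_ g); rewrite !ffunE eqxx; case: eqP => // _ /eqP;
    rewrite oner_eq0.
have nqN : (n ^ q)%g \in N by rewrite (memNJ S).
apply: gbase_inj; rewrite (split_dual_gbase (split_dual_N S) nqN).
rewrite (split_dual_gbase (split_dual_N S) nN) big_seq [RHS]big_seq.
apply: eq_bigr => psi /fq; rewrite inE => /andP[_ /eqP] /ffunP/(_ n).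
by rewrite ffunE => ->.
Qed.

Lemma dual_inv_N (psi : {ffun gT -> K}) : dual N psi -> dual N (dual_inv psi).
Proof. exact: (dual_invP (ts_abN S)). Qed.

(** On m q the weights of psi and its inverse multiply to 1 if q fixes psi and to 0 otherwise; the
    product over all psi detects q = 1. *)
Lemma weight_N_integral :
  integral_on Z (weight (fun g => (g \in N)%:R)).
Proof.
pose w psi g := stab_weight psi g * stab_weight (dual_inv psi) g.
have wP psi : psi \in charsN -> integral_on Z (weight (w psi)).
  move=> psis; have psiP : dual N psi by case: (split_dual_N S) => _ + _; apply.
  by apply: weight_integralM; apply: stab_weight_integral => //;
    apply: dual_inv_N.
(* The factor 1 off the list makes every factor integral, as [weight_integral_prod] asks. *)
pose w' psi := if psi \in charsN then w psi else fun=> 1.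
have w'P psi : integral_on Z (weight (w' psi)).
  by rewrite /w'; case: ifP => [/wP //|_]; apply: weight_integral1.
apply: (eq_integral_on (weight_integral_prod charsN w'P)) => u.
apply: eq_bigr => g _; congr (_ * _).
have [m [q [mN qQ ->]]] := sdprod_split (ts_sdprod S) g.
have wE psi : psi \in charsN -> w' psi (m * q)%g =
    if q \in stab psi then (if q \in stab (dual_inv psi) then 1 else 0) else 0.
  move=> psis; have psiP : dual N psi by case: (split_dual_N S) => _ + _; apply.
  rewrite /w' psis /w !stab_weightE //; case: ifP; rewrite ?mul0r //.
  case: ifP; rewrite ?mulr0 // => _ _.
  by rewrite ffunE (dualV psiP mN) mulfV //; case: psiP => _ ->.
rewrite groupMl //; have [q1|q1] := eqVneq q 1%g.
  rewrite q1 group1 big_seq big1 // => psi psis.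
  by have := wE psi psis; rewrite q1 !(group1 (stab_group _)).
have -> : (q \in N) = false.
  by apply: contraNF q1 => qN; apply/eqP/(sdprod_TI (ts_sdprod S)).
have [psi psis fq] : exists2 psi, psi \in charsN & q \notin stab psi.
  apply: contrapT => no; case/eqP: q1; apply: (stab_bigcap qQ) => psi psis.
  by apply: contraT => fq; case: no; exists psi.
by rewrite (big_rem psi) //= wE // (negPf fq) mul0r.
Qed.

(** The coordinate of x at psi and q is the value at x q^-1 of the indicator of [N] times the weight
    of psi, a product in the dual order. *)
Lemma order_sub_crossed_lattice : Z `<=` crossed_lattice N Q.
Proof.
move=> x Zx psi q psiP qQ.
have coordP := weight_integralM weight_N_integral (stab_weight_integral psiP).
have -> : crossed_coord N psi q x =
    weight (fun g => (g \in N)%:R * stab_weight psi g) (x * [q^-1]).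
  have xl : scalar (fun x => weight (fun g => (g \in N)%:R * stab_weight psi g)
    (x * [q^-1])).
    by move=> k u v; rewrite mulrDl -scalerAl weight_scalar.
  rewrite (galg_scalar x xl)
    (galg_scalar x (@crossed_coord_scalar _ _ N psi q)).
  apply: eq_bigr => g _; congr (_ * _); rewrite gbaseM weight_base.
  have [m [r [mN rQ ->]]] := sdprod_split (ts_sdprod S) g.
  rewrite (crossed_coord_base S) // -mulgA groupMl //.
  have rqQ : (r * q^-1)%g \in Q by rewrite groupM ?groupV.
  rewrite stab_weightE //; have [->|qr] := eqVneq q r.
    by rewrite mulgV group1 (group1 (stab_group psi)) mul1r.
  have -> : (r * q^-1)%g \in N = false.
    apply: contraNF qr => rqN; rewrite eq_sym eq_mulgV1.
    exact/eqP/(sdprod_TI (ts_sdprod S)).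
  by rewrite mul0r.
by apply: coordP.2; apply: (in_orderM orderZ) => //; apply: Zbase;
  rewrite groupV.
Qed.

End CrossedMaximal.

(** * The lattice is the unique Hopf order *)

Section CrossedHopfOrder.
Variables (K : fieldExtType rat) (gT : finGroupType) (N Q L P : {group gT})
  (tau : gT) (f : gT -> {ffun gT -> K}).
Hypothesis S : twist_setting N Q L P tau f.
Local Notation KG := (galg K gT).
Local Notation O := (@algebraic_integer K).
Local Notation iota := (val : {rmorphism ring_of_integers K -> K}).
Local Notation "[ g ]" := (gbase K g) (at level 0, g at level 99, format "[ g ]").
Local Notation X := (@crossed_lattice K gT N Q).
Local Notation E := (idemL L f).

Lemma crossed_reflexive : reflexive_order X.
Proof.
apply: reflexive_orderP.
- exact: (crossed_submodule S).
- exact: (crossed_fg S).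
- exact: (crossed_projective S).
- exact: (crossed_tensor S).
- exact: (crossed_lattice1 S).
- exact: (crossed_latticeM S).
Qed.

Lemma crossed_lattice_idemL x : x \in P -> X (E x).
Proof.
move=> xP; have -> : E x = \sum_(y in P) idemN L tau f x y.
  rewrite -mulr_sumr -mulr_suml -mulr_sumr (idemL_sum1 S) mulr1 gbaseVr.
  by rewrite mulr1.
apply: crossed_lattice_sum => y yP; rewrite -(char_idem_charN S) //.
exact: (crossed_lattice_idem S (charN_dual S xP yP)).
Qed.

Lemma crossed_lattice_P p : p \in P -> X [p].
Proof. by move=> pP; exact: (crossed_lattice_base S (P_sub_Q S pP)). Qed.

(** The elements with this property form a subalgebra, so the generators suffice; the counit and the
    antipode are treated in the same way. *)
Lemma crossed_gcomul u : X u -> order_square X (gcomul u).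
Proof.
have XX := crossed_reflexive.
apply: (crossed_lattice_min S (A := [set u | order_square X (gcomul u)])).
  split=> [||x y Ax Ay] /=.
  - split=> [|r x y Ax Ay] /=.
      by exists 0%N, (fun=> 0), (fun=> 0); rewrite linear0 big_ord0;
        split=> // -[].
    rewrite linearP; apply: order_squareD => //;
      apply: (order_squareZ XX) => //.
    by case: r.
  - rewrite gcomul1 -gtens11; apply: order_square_gtens;
    exact: (crossed_lattice1 S).
  - by rewrite gcomulM; apply: (order_squareM XX).
move=> x [[psi [psiP ->]]|[q [qQ ->]]] /=.
  rewrite (gcomul_char_idem (split_dual_N S)) big_seq.
  apply: order_square_sum => phi phis.
  have phiP : dual N phi by case: (split_dual_N S) => _ + _; apply.
  apply: order_square_gtens; apply: (crossed_lattice_idem S) => //.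
  by apply: dual_mulP => //; apply: (dual_invP (ts_abN S)).
by rewrite gcomul_base; apply: order_square_gtens;
  apply: (crossed_lattice_base S).
Qed.

Lemma crossed_gcounit u : X u -> gcounit u \in O.
Proof.
apply: (crossed_lattice_min S (A := [set u | gcounit u \in O])).
  split=> [||x y Ax Ay] /=.
  - split=> [|r x y Ax Ay] /=; first by rewrite linear0 rpred0.
    by rewrite linearP rpredD // rpredM //; case: r.
  - by rewrite -gbase1 gcounit_base rpred1.
  - by rewrite gcounitM rpredM.
move=> x [[psi [psiP ->]]|[q [qQ ->]]] /=; last by rewrite gcounit_base rpred1.
by rewrite gcounit_char_idem //; case: eqP => _; rewrite ?rpred1 ?rpred0.
Qed.

Lemma crossed_gantipode u : X u -> X (gantipode u).
Proof.
have XX := crossed_reflexive.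
apply: (crossed_lattice_min S (A := [set u | X (gantipode u)])).
  split=> [||x y Ax Ay] /=.
  - split=> [|r x y Ax Ay] /=; first by rewrite linear0; apply: in_order0.
    rewrite linearP; apply: (in_orderD XX _ Ay); apply: (in_orderZr XX _ Ax).
    by case: r.
  - by rewrite -gbase1 gantipode_base invg1 gbase1; exact: (crossed_lattice1 S).
  - by rewrite gantipodeM; apply: (in_orderM XX Ay Ax).
move=> x [[psi [psiP ->]]|[q [qQ ->]]] /=.
  rewrite gantipode_char_idem //; apply: (crossed_lattice_idem S).
  exact: (dual_invP (ts_abN S)).
by rewrite gantipode_base; apply: (crossed_lattice_base S); rewrite groupV.
Qed.

Lemma gmul_antipode_sum (I : Type) (s : seq I) (B : pred I) (u v : I -> KG) :
  gmul_antipode (\sum_(i <- s | B i) gtens (u i) (v i)) =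
  \sum_(i <- s | B i) u i * gantipode (v i).
Proof.
have lin : linear (@gmul_antipode K gT).
  move=> k w w'; rewrite /gmul_antipode scaler_sumr -big_split;
    apply: eq_bigr => p _.
  by rewrite galgDE galgZE scalerDl scalerA.
pose M : {linear galg K (gT * gT)%type -> KG} :=
  HB.pack (@gmul_antipode K gT) (GRing.isLinear.Build _ _ _ _ _ lin).
rewrite -[gmul_antipode _]/(M _) linear_sum; apply: eq_bigr => i _.
rewrite -[LHS]/(gmul_antipode _) {2}[u i]galg_sum {2}[v i]galg_sum.
rewrite linear_sum big_distrlr pair_big; apply: eq_bigr => -[g h] _ /=.
by rewrite ffunE linearZ /= -scalerAl -scalerAr scalerA.
Qed.

(** The twist and its inverse lie in the square of the lattice. *)
Lemma crossed_comulJ u : X u -> order_square X (comulJ L P f u).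
Proof.
have XX := crossed_reflexive => Xu; have sq (g : gT -> gT) :
    (forall x, x \in P -> g x \in P) ->
      order_square X (\sum_(x in P) gtens (E x) [g x]).
  move=> gP; apply: order_square_sum => x xP; apply: order_square_gtens.
    exact: crossed_lattice_idemL.
  by apply: crossed_lattice_P; apply: gP.
apply: (order_squareM XX); last by apply: sq => x xP; rewrite groupV.
by apply: (order_squareM XX); [apply: sq | apply: crossed_gcomul].
Qed.

Lemma sum_idemL_base (g h : gT -> gT) :
  (forall x, x \in P -> g x \in P) ->
  (\sum_(x in P) E x * [g x]) * (\sum_(x in P) E x * [h x]) =
  \sum_(x in P) E x * [g x * h x].
Proof.
move=> gP; rewrite big_distrlr /=; apply: eq_bigr => x xP.
rewrite (bigD1 x) //= big1 ?addr0 => [|y /andP[yP /negPf yx]].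
  by rewrite mulrA -(mulrA (E x)) (idemL_baseC S) ?gP // mulrA
    (idemLM S) // eqxx
    -mulrA gbaseM.
rewrite mulrA -(mulrA (E x)) (idemL_baseC S) ?gP // mulrA
  (idemLM S) // eq_sym yx.
by rewrite !mul0r.
Qed.

(** The element U_J is the sum of the [E x * [x^-1]] and its inverse that of the [E x * [x]]; both
    lie in the lattice. *)
Lemma crossed_antipodeJ u : X u ->
  X (gmul_antipode (twistJ L P f) * gantipode
    u * (gmul_antipode (twistJ L P f))^-1).
Proof.
have XX := crossed_reflexive => Xu.
have -> : gmul_antipode (twistJ L P f) = \sum_(x in P) E x * [x^-1].
  by rewrite gmul_antipode_sum; apply: eq_bigr => x _; rewrite gantipode_base.
have E1 : \sum_(x in P) E x * gbase K 1 = 1.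
  by rewrite -mulr_suml (idemL_sum1 S) mul1r.
have -> : (\sum_(x in P) E x * [x^-1])^-1 = \sum_(x in P) E x * [x].
  apply: mulr_inv; rewrite -[RHS]E1.
    rewrite sum_idemL_base => [|x xP]; last by rewrite groupV.
    by apply: eq_bigr => x _; rewrite mulVg.
  by rewrite (sum_idemL_base (g := id)) //; apply: eq_bigr => x _;
    rewrite mulgV.
have inX (g : gT -> gT) : (forall x, x \in P -> g x \in P) ->
  X (\sum_(x in P) E x * [g x]).
  move=> gP; apply: crossed_lattice_sum => x xP; apply: (in_orderM XX).
    exact: crossed_lattice_idemL.
  by apply: crossed_lattice_P; apply: gP.
apply: (in_orderM XX); last exact: inX.
apply: (in_orderM XX); last exact: crossed_gantipode.
by apply: inX => x xP; rewrite groupV.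
Qed.

Local Notation KGJ := (twisted_galg (twist L P f)).

Lemma crossed_hopf_order : is_hopf_order (ring_of_integers K) (X : set KGJ).
Proof.
split.
- exact: (crossed_submodule S).
- exact: (crossed_fg S).
- exact: (crossed_projective S).
- exact: (crossed_tensor S).
- exact: (crossed_lattice1 S).
- exact: (crossed_latticeM S).
- by move=> x Xx; rewrite /= (twistE S) (twistJ_inv S); apply: crossed_comulJ.
- by move=> x Xx; exists (RingOfIntegers (crossed_gcounit Xx)).
- by move=> x Xx; rewrite /= (twistE S); apply: crossed_antipodeJ.
Qed.

Lemma hopf_order_unique (Z : set KGJ) : is_hopf_order (ring_of_integers K) Z ->
  Z = X.
Proof.
case=> subZ fgZ projZ tensZ Z1 ZM ZD Ze _.
have orderZ : reflexive_order (Z : set KG) by apply: reflexive_orderP.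
have ZJ z : Z z -> order_square (Z : set KG) (comulJ L P f z).
  by move=> /ZD; rewrite /= (twistE S) (twistJ_inv S).
have Zcounit z : Z z -> gcounit (z : KG) \in O by move=> /Ze[[r rO] /= zr];
  rewrite -zr.
have Zidem := order_char_idem S orderZ ZJ.
have Zbase := order_gbase S orderZ ZJ.
apply/seteqP; split.
  exact: (order_sub_crossed_lattice S orderZ
    (order_gcomul S orderZ ZJ) Zcounit).
apply: (crossed_lattice_min S); first by split.
by move=> x [[psi [psiP ->]]|[q [qQ ->]]]; [apply: Zidem | apply: Zbase].
Qed.

End CrossedHopfOrder.

Theorem theorem5p1 (K : fieldExtType rat) (gT : finGroupType)
    (N Q L P : {group gT}) (tau : gT) (f : gT -> {ffun gT -> K})
    (hsplit : splits_as_algebra (galg K (subg_of N)))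
    (hG : (N ><| Q)%g = [set: gT]%SET) (abN : abelian N)
    (sLN : L \subset N) (abL : abelian L)
    (sPQ : P \subset Q) (abP : abelian P) (tauQ : tau \in Q)
    (isoLP : L \isog P) (cLP : P \subset 'C(L)%g)
    (faithQ : [faithful Q, on N | 'J])
    (hN : (L \x (L :^ tau^-1))%g = N)
    (fixN : ('Fix_(N | 'J)[tau])%g <> 1%g)
    (fix_dual : forall sigma, sigma \in P -> sigma != 1%g ->
       dual_fix N (sigma * tau)%g = [set trivial_char K N] /\
       dual_fix N tau `&` dual_fix N (sigma * tau * sigma^-1)%g
         = [set trivial_char K N])
    (fiso : dual_iso P L f) :
  let R := ring_of_integers K in
  let KGJ := twisted_galg (twist L P f) in
  let X := subalgebra_generated (val : {rmorphism R -> K})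
    [set x : galg K gT | (exists nu, dual N nu /\ x = char_idem N nu) \/
                         (exists q, q \in Q /\ x = gbase K q)] in
  exists Y : set KGJ,
    [/\ is_hopf_order R Y,
        forall Z : set KGJ, is_hopf_order R Z -> Z = Y
      & Y = X].
Proof.
move=> R KGJ X; have S : twist_setting N Q L P tau f by split.
exists (@crossed_lattice K gT N Q); split.
- exact: (crossed_hopf_order S).
- exact: (hopf_order_unique S).
- exact/esym/(subalgebra_generatedE S).
Qed.
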